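(* For every integer $N\geq 1$, the set of $\beta\in(1,\infty)$ such that the function $z\mapsto 1-\phi_\beta(\beta z)=1-\sum_{n=1}^\infty a_n(\beta,1)z^n$ has at least $N$ zeros in the open unit disk $\{z\in\mathbb{C} : |z|<1\}$ is open and dense in $(1,\infty)$. In particular, the set of $\beta\in(1,\infty)$ such that the Perron-Frobenius operator $\mathcal{L}_\beta$ has at least one non-leading eigenvalue is open and dense in $(1,\infty)$.
   Context: For real $\beta>1$, the beta-map is $\tau_\beta:[0,1]\to[0,1]$, $\tau_\beta(x)=\beta x-[\beta x]$, where $[y]$ is the integer part of $y\ge 0$; $\tau_\beta^0(x)=x$. For $x\in[0,1]$ and $n\ge1$ put $a_n(\beta,x)=[\beta\tau_\beta^{n-1}(x)]$. Define the power series $\phi_\beta(z)=\sum_{n=1}^\infty \frac{a_n(\beta,1)}{\beta^n}z^n$, which is analytic on $\{|z|<\beta\}$. Let $BV$ be the Banach space of functions $f:[0,1]\to\mathbb{C}$ of bounded variation with norm $\|f\|_{BV}=\operatorname{var}(f)+\sup_{x\in[0,1]}|f(x)|$, let $\mathcal{N}\subset BV$ be the closed subspace of those $f\in BV$ that vanish outside some countable set, and let $\widehat{BV}=BV/\mathcal{N}$ with the quotient norm. The Perron-Frobenius operator is $\mathcal{L}_\beta f(x)=\frac1\beta\sum_{y\in[0,1],\,\tau_\beta(y)=x}f(y)$, acting as a bounded linear operator on $BV$ and on $\widehat{BV}$; here it is considered on $\widehat{BV}$. Every spectral value $\lambda$ of $\mathcal{L}_\beta$ with $|\lambda|>1/\beta$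 is an isolated eigenvalue of finite multiplicity and satisfies $|\lambda|\le 1$; ''isolated eigenvalue'' means an eigenvalue $\lambda$ with $|\lambda|>1/\beta$. The number $1$ is the leading eigenvalue; a non-leading eigenvalue is an isolated eigenvalue (so $|\lambda|>1/\beta$) different from $1$. *)

(* Defs.v *)
From HB Require Import structures.
From mathcomp Require Import all_boot all_order all_algebra.
From mathcomp Require Import all_classical all_reals all_analysis.
From mathcomp Require Import complex.
Set Implicit Arguments.
Unset Strict Implicit.
Unset Printing Implicit Defensive.

Import Order.TTheory GRing.Theory Num.Theory numFieldNormedType.Exports.

Local Open Scope classical_set_scope.
Local Open Scope ring_scope.
Local Open Scope complex_scope.
Local Open Scope quotient_scope.

(* [R[i]] does not carry its norm topology by default. *)
HB.instance Definition _ (R : realType) := NormedModule.copy R[i] R[i]^o.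

Section beta_expansion.
Variable R : realType.
Implicit Types (beta x : R) (z : R[i]).

Definition beta_map beta x : R := beta * x - (Num.floor (beta * x))%:~R.

(* Only meaningful for [0 < n]; every number whose floor is taken is then
   nonnegative when [0 < beta] and [0 <= x]. *)
Definition digit beta x (n : nat) : int :=
  Num.floor (beta * iter n.-1 (beta_map beta) x).

Definition phi beta z : R[i] :=
  \big[+%R/0]_(1 <= n <oo) (((digit beta 1 n)%:~R / beta ^+ n)%:C * z ^+ n).

Lemma phi_beta beta z : beta != 0 -> phi beta (beta%:C * z) =
  \big[+%R/0]_(1 <= n <oo) ((digit beta 1 n)%:~R%:C * z ^+ n).
Proof.
move=> b0; rewrite /phi; congr (limn _); apply/funext => m.
apply: eq_bigr => n _; rewrite exprMn mulrA; congr (_ * _).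
by rewrite -rmorphXn -rmorphM/= mulfVK// expf_neq0.
Qed.

End beta_expansion.

Definition unit_itv (R : realType) : set R := `[0, 1]%classic.
Arguments unit_itv : clear implicits.

Section bounded_variation_functions.
Variable R : realType.
Local Notation I := (unit_itv R).


(* Since the points of the subdivision may be repeated, the sums below are
   exactly those over the finite subdivisions of the unit interval. *)
Definition is_bounded_variation (f : I -> R[i]) : Prop :=
  exists M : R, forall (t : nat -> I) (n : nat),
    {homo t : i j / (i <= j)%N >-> \val i <= \val j} ->
    \sum_(i < n) `|f (t i.+1) - f (t i)| <= M%:C.

Definition bv_pred : {pred I -> R[i]} :=
  [pred f | `[< is_bounded_variation f >]].

Lemma bv_predP f : reflect (is_bounded_variation f) (f \in bv_pred).
Proof. exact: asboolP. Qed.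

Lemma bv_submod : submod_closed bv_pred.
Proof.
split.
  apply/bv_predP; exists 0 => t n _; rewrite big1// => i _.
  by rewrite subrr normr0.
move=> a f g /bv_predP[M Mf] /bv_predP[M' Mg]; apply/bv_predP.
exists (complex.Re `|a| * M + M') => t n ht.
have -> : (complex.Re `|a| * M + M')%:C = `|a| * M%:C + M'%:C.
  by rewrite [LHS]rmorphD [X in X + _]rmorphM; congr (_ * _ + _); exact/RRe_real/normr_real.
apply: (@le_trans _ _ (\sum_(i < n) (`|a| * `|f (t i.+1) - f (t i)| +
                                    `|g (t i.+1) - g (t i)|))).
  apply: ler_sum => i _; rewrite -normrM mulrBr.
  apply: le_trans (ler_normD _ _).
  by rewrite !fctE opprD addrACA.
rewrite big_split/= -mulr_sumr lerD ?Mg// ler_wpM2l ?normr_ge0//.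
exact: Mf.
Qed.

HB.instance Definition _ := GRing.isSubmodClosed.Build _ _ bv_pred bv_submod.

Record BV := MkBV { bv_fun :> I -> R[i] ; bv_funP : bv_fun \in bv_pred }.

HB.instance Definition _ := [isSub for bv_fun].
HB.instance Definition _ := [Choice of BV by <:].
HB.instance Definition _ := [SubChoice_isSubLmodule of BV by <:].

Definition bv_null : {pred BV} := [pred f : BV |
  `[< exists A : set I, countable A /\ forall x, ~ A x -> f x = 0 >]].

Lemma bv_null_submod : submod_closed bv_null.
Proof.
split.
  by apply/asboolP; exists set0; split.
move=> a f g /asboolP[A [cA Af]] /asboolP[B [cB Bg]]; apply/asboolP.
exists (A `|` B); split; first by rewrite -bigcup2E; apply: bigcup_countable => // -[|[|]].
move=> x /not_orP[/Af fx /Bg gx].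
by rewrite /= !fctE fx gx scaler0 addr0.
Qed.

HB.instance Definition _ :=
  GRing.isSubmodClosed.Build _ _ bv_null bv_null_submod.

End bounded_variation_functions.

Section BVhat_lmodule.
Variable R : realType.

Definition BVhat := Quotient.quot (@bv_null R).

HB.instance Definition _ := GRing.Zmodule.on BVhat.
HB.instance Definition _ := EqQuotient.on BVhat.

Implicit Types (a b : R[i]) (f : BV R) (u v : BVhat).

Definition bvhat_scale a u : BVhat := \pi_BVhat (a *: repr u).

Lemma pi_scale a f : bvhat_scale a (\pi_BVhat f) = \pi_BVhat (a *: f).
Proof.
apply/eqP; rewrite /bvhat_scale -Quotient.idealrBE -scalerBr.
by apply: rpredZ; rewrite Quotient.idealrBE reprK.
Qed.

Lemma bvhat_scaleA a b u :
  bvhat_scale a (bvhat_scale b u) = bvhat_scale (a * b) u.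
Proof. by elim/quotW: u => f; rewrite [bvhat_scale b _]pi_scale !pi_scale scalerA. Qed.

Lemma bvhat_scale1 : left_id 1 bvhat_scale.
Proof. by elim/quotW => f; rewrite pi_scale scale1r. Qed.

Lemma bvhat_scaleDr : right_distributive bvhat_scale +%R.
Proof.
move=> a; elim/quotW => f; elim/quotW => g.
by rewrite -pi_addr !pi_scale scalerDr pi_addr.
Qed.

Lemma bvhat_scaleDl u : {morph bvhat_scale^~ u : a b / a + b}.
Proof. by elim/quotW: u => f a b; rewrite /= !pi_scale scalerDl pi_addr. Qed.

HB.instance Definition _ := GRing.Zmodule_isLmodule.Build R[i] BVhat
  bvhat_scaleA bvhat_scale1 bvhat_scaleDr bvhat_scaleDl.

Lemma piZ a f : \pi_BVhat (a *: f) = a *: \pi_BVhat f.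
Proof. by rewrite -pi_scale. Qed.

Lemma pi_eq0 f : (\pi_BVhat f == 0) = (f \in @bv_null R).
Proof. by rewrite -[0]pi_zeror -Quotient.idealrBE subr0. Qed.

End BVhat_lmodule.

Definition is_eigenvalue (K : pzRingType) (V : lmodType K) (T : V -> V) (a : K) :=
  exists2 v : V, v != 0 & T v = a *: v.

Section transfer_operator.
Variable R : realType.
Local Notation I := (unit_itv R).
Implicit Types (beta : R) (x y : I) (f g : I -> R[i]).

(* For [1 < beta] the index set is finite (see [branch_bij] below), so that
   [\sum_(_ \in _)] is the actual sum. *)
Definition transfer beta f : I -> R[i] := fun x =>
  (beta^-1)%:C * \sum_(y \in [set y : I | beta_map beta (\val y) = \val x]) f y.

Lemma unit_itvP x : 0 <= \val x <= 1.
Proof. by case: x => x /= /set_mem; rewrite /unit_itv/= in_itv/=. Qed.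

Lemma unit_itv_proof (v : R) : 0 <= v <= 1 -> v \in unit_itv R.
Proof. by move=> h; apply/mem_set; rewrite /unit_itv/= in_itv/=. Qed.

Definition mk_unit (v : R) (h : 0 <= v <= 1) : I :=
  SigSub (unit_itv_proof h).

Lemma bv_bounded f : is_bounded_variation f ->
  exists S : R, forall x, `|f x| <= S%:C.
Proof.
have h0 : 0 <= (0 : R) <= 1 by rewrite lexx ler01.
move=> [M Mf]; exists (complex.Re `|f (mk_unit h0)| + M) => x.
have -> : (complex.Re `|f (mk_unit h0)| + M)%:C = `|f (mk_unit h0)| + M%:C.
  by rewrite [LHS]rmorphD; congr (_ + _); exact/RRe_real/normr_real.
have := Mf (fun i => if i is 0%N then mk_unit h0 else x) 1%N.
rewrite big_ord1/= => /(_ _)/le_trans hM.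
rewrite -[f x](subrK (f (mk_unit h0))) addrC.
rewrite (le_trans (ler_normD _ _))// lerD2l.
apply: hM => // -[|i] [|j]//= _.
by case/andP: (unit_itvP x).
Qed.

Lemma bv_cut f (p : I -> bool) (e : I -> I) :
  (forall x y, \val x <= \val y -> p y -> p x) ->
  (forall x y, \val x <= \val y -> \val (e x) <= \val (e y)) ->
  is_bounded_variation f ->
  is_bounded_variation (fun x => if p x then f (e x) else 0).
Proof.
move=> p_dec e_inc bvf; have [S Sf] := bv_bounded bvf; case: bvf => M Mf.
have S0 : 0 <= S.
  have h0 : 0 <= (0 : R) <= 1 by rewrite lexx ler01.
  by rewrite -ler0c; apply: le_trans (Sf (mk_unit h0)); exact: normr_ge0.
exists (M + S) => t n ht; rewrite [(M + S)%:C]rmorphD.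
pose g x : R[i] := if p x then f (e x) else 0.
rewrite -[X in X <= _]/(\sum_(i < n) `|g (t i.+1) - g (t i)|).
have gE x : g x = if p x then f (e x) else 0 by [].
clearbody g.
have inside m : p (t m) -> \sum_(i < m) `|g (t i.+1) - g (t i)| <= M%:C.
  move=> ptm; have pt i : (i <= m)%N -> p (t i).
    by move=> im; apply: p_dec ptm; exact: ht.
  pose t' i := e (t (minn i m)).
  rewrite (_ : \sum_(i < m) _ = \sum_(i < m) `|f (t' i.+1) - f (t' i)|).
    apply: Mf => i j ij; apply: e_inc; apply: ht.
    by rewrite leq_min geq_minr andbT (leq_trans (geq_minl _ _)).
  apply: eq_bigr => i _; rewrite !gE !pt//; last exact: ltnW.
  by rewrite /t' (minn_idPl _)// (minn_idPl _)// ltnW.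
have [ptn|] := boolP (p (t n)).
  by rewrite (le_trans (inside _ ptn))// lerDl ler0c.
elim: n => [|n IHn] ptn.
  rewrite big_ord0 -[X in _ <= X + _]/(M%:C).
  have M0 : 0 <= M%:C :> R[i] by have := Mf t 0%N ht; rewrite big_ord0.
  by rewrite addr_ge0// ler0c.
have gn : g (t n.+1) = 0 by rewrite gE (negbTE ptn).
rewrite big_ord_recr/= gn sub0r normrN.
have [ptn'|ptn'] := boolP (p (t n)).
  by rewrite lerD ?inside// gE ptn'.
by rewrite [g (t n)]gE (negbTE ptn') normr0 addr0 IHn.
Qed.

Section branches.
Variables (beta : R) (beta_gt1 : 1 < beta).

Let beta_gt0 : 0 < beta. Proof. exact: lt_trans beta_gt1. Qed.

Lemma branch_proof (k : nat) x :
  0 <= Num.min 1 ((\val x + k%:R) / beta) <= 1.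
Proof.
rewrite le_min ler01/= ge_min lexx/= andbT divr_ge0 ?(ltW beta_gt0)//.
by rewrite addr_ge0//; case/andP: (unit_itvP x).
Qed.

(* Where [branch_dom k x] holds, this is the preimage [(x + k) / beta] of [x];
   elsewhere the value is junk. *)
Definition branch k x : I := mk_unit (branch_proof k x).

Definition branch_dom (k : nat) x : bool :=
  (\val x < 1) && (\val x + k%:R <= beta).

Definition nbranch : nat := `|Num.floor beta|.+1.

Lemma branch_val k x : branch_dom k x -> beta * \val (branch k x) = \val x + k%:R.
Proof.
move=> /andP[_ h]; rewrite /= min_r ?ler_pdivrMr ?mul1r//.
by rewrite mulrC divfK// gt_eqF.
Qed.

Lemma branch_bij x : set_bij (`I_nbranch `&` [set k | branch_dom k x])
  [set y : I | beta_map beta (\val y) = \val x] (branch^~ x).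
Proof.
have /andP[x0 x1] := unit_itvP x.
split.
- move=> k [/= _ kx]; rewrite /beta_map branch_val//.
  have /andP[xl1 _] := kx; rewrite (@floor_def _ _ k%:Z) ?addrK//.
  by rewrite intrD -!pmulrn lerDr x0/= addrC ltrD2l.
- move=> k l /[!inE] -[/= _ kx] [_ lx] kl.
  have : \val x + k%:R = \val x + l%:R by rewrite -!branch_val// kl.
  by move=> /addrI/eqP; rewrite eqr_nat => /eqP.
- move=> y /= yx; have /andP[y0 y1] := unit_itvP y.
  have by0 : 0 <= beta * \val y by rewrite mulr_ge0// ltW.
  have byb : beta * \val y <= beta by rewrite ler_piMr// ltW.
  have fly : (`|Num.floor (beta * \val y)|%N)%:R = (Num.floor (beta * \val y))%:~R :> R.
    by rewrite pmulrn gez0_abs// floor_ge0.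
  have xk : \val x + `|Num.floor (beta * \val y)|%:R = beta * \val y.
    by rewrite -[\val x]yx /beta_map fly subrK.
  exists `|Num.floor (beta * \val y)|%N.
    split; rewrite /= ?/branch_dom ?xk ?byb ?andbT.
      rewrite ltnS -lez_nat !gez0_abs ?floor_ge0 ?(ltW beta_gt0)//.
      exact: le_floor.
    rewrite -[\val x]yx.
    by rewrite /beta_map ltrBlDr addrC -intrD1 floorD1_gt.
  apply/val_inj; rewrite /= xk mulrC mulKf ?gt_eqF// min_r//.
Qed.

Lemma transferE f x : transfer beta f x = (beta^-1)%:C *
  \sum_(k < nbranch) (if branch_dom k x then f (branch k x) else 0).
Proof.
rewrite /transfer (@reindex_fsbig _ _ _ _ _ (branch^~ x) _ _ f (branch_bij x)) fsbig_mkcondr.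
rewrite (fsbig_ord _ _ (fun k => if branch_dom k x then f (branch k x) else 0)).
by congr (_ * _); apply: eq_fsbigr => k _; rewrite mem_setE.
Qed.

Lemma transfer_bv f : f \in @bv_pred R -> transfer beta f \in @bv_pred R.
Proof.
move=> /bv_predP bvf.
have -> : transfer beta f = (beta^-1)%:C *: \sum_(k < nbranch)
    (fun x => if branch_dom k x then f (branch k x) else 0).
  by apply/funext => x; rewrite transferE !fctE/= fct_sumE.
apply: rpredZ; apply: rpred_sum => k _; apply/bv_predP; apply: bv_cut bvf.
  move=> x y xy /andP[y1 yk]; apply/andP; split; first exact: le_lt_trans y1.
  by apply: le_trans yk; rewrite lerD2r.
move=> x y xy /=; rewrite le_min !ge_min lexx/=.
by rewrite ler_pM2r ?invr_gt0// lerD2r xy orbT.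
Qed.

Lemma transfer_linear : linear (transfer beta).
Proof.
move=> a f g; apply/funext => x.
rewrite -[RHS]/(a * transfer beta f x + transfer beta g x) !transferE.
rewrite [in RHS]mulrCA -mulrDr [in RHS]mulr_sumr -big_split/=.
by congr (_ * _); apply: eq_bigr => k _; case: ifP; rewrite ?mulr0 ?addr0.
Qed.

Lemma transfer_null f (A : set I) :
  countable A -> (forall x, ~ A x -> f x = 0) ->
  exists B : set I, countable B /\ forall x, ~ B x -> transfer beta f x = 0.
Proof.
move=> cA fA.
have map01 y : 0 <= beta_map beta (\val y) <= 1.
  by rewrite /beta_map subr_ge0 floor_le lerBlDr addrC -intrD1 ltW ?floorD1_gt.
exists ((fun y => mk_unit (map01 y)) @` A); split.
  exact: sub_countable (card_image_le _ _) cA.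
move=> x Bx; rewrite /transfer fsbig1 ?mulr0// => y /= yx.
by apply: fA => Ay; apply: Bx; exists y => //; exact/val_inj.
Qed.

End branches.

Definition betas : set R := `]1, +oo[%classic.

Lemma betas_gt1 (b : betas) : 1 < \val b.
Proof. by case: b => b /= /set_mem; rewrite /betas/= in_itv/= andbT. Qed.

Definition transfer_BV (b : betas) (f : BV R) : BV R :=
  MkBV (transfer_bv (betas_gt1 b) (bv_funP f)).

Lemma transfer_BV_linear b : linear (transfer_BV b).
Proof. by move=> a f g; apply/val_inj; exact: (transfer_linear (betas_gt1 b)). Qed.

HB.instance Definition _ b :=
  GRing.isLinear.Build R[i] (BV R) (BV R) _ (transfer_BV b)
    (transfer_BV_linear b).

Lemma transfer_BV_null b (f : BV R) :
  f \in @bv_null R -> transfer_BV b f \in @bv_null R.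
Proof.
move=> /asboolP[A [cA fA]]; apply/asboolP.
have [B [cB fB]] := transfer_null (\val b) cA fA.
by exists B; split.
Qed.

(* Independent of the representative by [pi_transfer] below. *)
Definition transfer_BVhat (b : betas) (u : BVhat R) : BVhat R :=
  \pi_(BVhat R) (transfer_BV b (repr u)).

Lemma pi_transfer b (f : BV R) :
  transfer_BVhat b (\pi_(BVhat R) f) = \pi_(BVhat R) (transfer_BV b f).
Proof.
apply/eqP; rewrite /transfer_BVhat -Quotient.idealrBE -linearB.
by apply: transfer_BV_null; rewrite Quotient.idealrBE reprK.
Qed.

Lemma transfer_BVhat_linear b : linear (transfer_BVhat b).
Proof.
move=> a; elim/quotW => f; elim/quotW => g.
by rewrite !pi_transfer -!piZ -!pi_addr pi_transfer linearP.
Qed.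

HB.instance Definition _ b :=
  GRing.isLinear.Build R[i] (BVhat R) (BVhat R) _ (transfer_BVhat b)
    (transfer_BVhat_linear b).

Lemma eigenvalue_BVhatP b (lam : R[i]) :
  is_eigenvalue (transfer_BVhat b) lam <->
  exists2 f : BV R, f \notin @bv_null R &
                    transfer_BV b f - lam *: f \in @bv_null R.
Proof.
split=> [[u]|[f f0 fE]].
  elim/quotW: u => f; rewrite pi_eq0 pi_transfer -piZ => f0 /eqP fE.
  by exists f => //; rewrite Quotient.idealrBE.
exists (\pi_(BVhat R) f); first by rewrite pi_eq0.
by rewrite pi_transfer -piZ; apply/eqP; rewrite -Quotient.idealrBE.
Qed.

Definition isolated_eigenvalue (b : betas) (lam : R[i]) : Prop :=
  is_eigenvalue (transfer_BVhat b) lam /\ (\val b)^-1%:C < `|lam|.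

Definition non_leading_eigenvalue (b : betas) (lam : R[i]) : Prop :=
  isolated_eigenvalue b lam /\ lam != 1.

End transfer_operator.

Arguments betas : clear implicits.

(* Main.v *)
From HB Require Import structures.
Require Import Defs.
From mathcomp Require Import all_boot all_order all_algebra.
From mathcomp Require Import all_classical all_reals all_analysis.
From mathcomp Require Import complex polyrcf.
From mathcomp Require Import ring lra.

Set Implicit Arguments.
Unset Strict Implicit.
Unset Printing Implicit Defensive.

Import Order.TTheory GRing.Theory Num.Theory numFieldNormedType.Exports.

Local Open Scope classical_set_scope.
Local Open Scope ring_scope.
Local Open Scope complex_scope.

(** For [|z| < 1] the function [1 - phi b (b z)] is the power series
    [beta_series b z] with constant coefficient [1] and the other coefficients
    [- digit b 1 n], which are bounded by [b].

    Openness.  Near [b] many digits of [1] are constant on either side of [b]: from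
    the right they are those of [b] ([digit_right]), from the left those of the
    orbit that takes the branches closed on the right ([digit_near_left]).  The
    two limit series differ at most by a factor [1 - z ^+ m], which has no zero in
    the disc ([beta_series_left_zero]).  It remains to see that a zero of a power
    series survives when only far coefficients change, within a fixed bound
    ([zero_persists], a form of Hurwitz's theorem).  This needs no complex
    integration: zeros are isolated because one can divide by [z - w]
    ([zeros_isolated]), and a polynomial that is small at the centre of a disc
    compared with its values on the boundary has a root in the disc, by evaluating
    a product over the roots of ['X^N - rho ^+ N] in two ways
    ([poly_root_disc]).

    Density.  Parameters at which the orbit of [1] reaches [0] are dense
    ([finite_orbit_dense]); for them the series is a polynomial [p].  Moving the
    parameter slightly to the right one can realise [p - 'X^M] for every large [M]
    ([add_digit]).  This leaves the values at given points of [(-1, 0)] almost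
    unchanged, but moves the value at [-1] by one unit up or down according to the
    parity of [M].  So one sign change after the other can be produced on
    [(-1, 0)] ([alternating_dense]), and each of them is a zero.

    Spectrum.  The eigenvalues [lam] with [1 / b < |lam|] are exactly the
    [1 / (b z)] with [z] a zero in the disc.  The operator maps the indicator of
    [[0, t[], for [t] in the orbit of [1], to a constant plus a multiple of the
    indicator of [[0, beta_map b t[] ([count_preimages]), so the sum [eigenfun] of
    these indicators with weights [z ^+ n] is an eigenfunction up to the constant
    [beta_series b z] ([eigenfun_transfer], [zero_is_eigenvalue]).  Conversely an
    eigenfunction, less the multiple of [eigenfun] with the same jump at [1], has
    no variation, because the operator contracts it ([contraction_eq0],
    [eigenvalue_is_zero]).  Since [z = 1 / b], which corresponds to the eigenvalue
    [1], is always a zero, a non-leading eigenvalue exists if and only if there are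
    two distinct zeros, and the statement on the operator is the case of two
    zeros. *)

(** * The modulus of a complex number *)

(** The norm of [R[i]] takes its values in [R[i]]; estimates are carried out on
    this real-valued version of it.  It is locked because unfolding the square
    root in failed unifications is very expensive. *)
HB.lock Definition modulus (R : realType) (z : R[i]) : R := Normc.normc z.

Section modulus_theory.
Variable R : realType.
Implicit Types (x : R) (z w : R[i]).

Lemma normE z : `|z| = (modulus z)%:C. Proof. by rewrite modulus.unlock. Qed.

Lemma modulus_ge0 z : 0 <= modulus z.
Proof. by rewrite modulus.unlock; case: z => a b; exact: sqrtr_ge0. Qed.

Lemma modulus0 : modulus 0 = 0 :> R.
Proof. by rewrite modulus.unlock Normc.normc0. Qed.

Lemma modulus1 : modulus 1 = 1 :> R.
Proof. by rewrite modulus.unlock Normc.normc1. Qed.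

Lemma modulus_eq0 z : (modulus z == 0) = (z == 0).
Proof.
apply/eqP/eqP => [|->]; last exact: modulus0.
by rewrite modulus.unlock => /Normc.eq0_normc.
Qed.

Lemma modulus_gt0 z : (0 < modulus z) = (z != 0).
Proof. by rewrite lt_def modulus_ge0 andbT modulus_eq0. Qed.

Lemma modulusM : {morph @modulus R : z w / z * w}.
Proof. by move=> z w; rewrite modulus.unlock Normc.normcM. Qed.

Lemma modulusX n : {morph @modulus R : z / z ^+ n}.
Proof.
by move=> z; elim: n => [|n IHn]; rewrite ?modulus1// !exprS modulusM IHn.
Qed.

Lemma modulusV : {morph @modulus R : z / z^-1}.
Proof. by move=> z; rewrite modulus.unlock Normc.normcV. Qed.

Lemma modulusN z : modulus (- z) = modulus z.
Proof. by rewrite modulus.unlock normcN. Qed.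

Lemma modulusD z w : modulus (z + w) <= modulus z + modulus w.
Proof. by rewrite modulus.unlock le_normcD. Qed.

Lemma modulusB z w : modulus (z - w) = modulus (w - z).
Proof. by rewrite -modulusN opprB. Qed.

Lemma modulus_triangle w z t :
  modulus (z - t) <= modulus (z - w) + modulus (w - t).
Proof. by rewrite (le_trans _ (modulusD _ _))// addrA subrK. Qed.

Lemma modulus_dist z w : modulus z <= modulus w + modulus (z - w).
Proof. by rewrite (le_trans _ (modulusD _ _))// addrC subrK. Qed.

Lemma modulus_real x : modulus x%:C = `|x|.
Proof. by rewrite modulus.unlock/= expr0n/= addr0 sqrtr_sqr. Qed.

Lemma modulus_sum (I : Type) (r : seq I) (P : pred I) (F : I -> R[i]) :
  modulus (\sum_(i <- r | P i) F i) <= \sum_(i <- r | P i) modulus (F i).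
Proof.
elim/big_ind2 : _ => [|x1 x2 y1 y2 h1 h2|//]; first by rewrite modulus0.
by rewrite (le_trans (modulusD _ _))// lerD.
Qed.

Lemma modulus_prod (I : Type) (r : seq I) (P : pred I) (F : I -> R[i]) :
  modulus (\prod_(i <- r | P i) F i) = \prod_(i <- r | P i) modulus (F i).
Proof. exact: (big_morph (@modulus R) modulusM modulus1). Qed.

Lemma Re_le_modulus z : `|complex.Re z| <= modulus z.
Proof. by rewrite -lecR -normE; exact: normc_ge_Re. Qed.

Lemma Im_le_modulus z : `|complex.Im z| <= modulus z.
Proof.
case: z => a b; rewrite modulus.unlock/= -sqrtr_sqr ler_sqrt ?sqr_ge0//.
  by rewrite lerDr sqr_ge0.
by rewrite addr_ge0 ?sqr_ge0.
Qed.

Lemma modulus_le_ReIm z :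
  modulus z <= `|complex.Re z| + `|complex.Im z|.
Proof.
have i1 : modulus ('i : R[i]) = 1.
  by rewrite modulus.unlock /= expr0n/= add0r expr1n sqrtr1.
rewrite [z in modulus z]complexE (le_trans (modulusD _ _))//.
by rewrite modulusM !modulus_real i1 mul1r.
Qed.

Lemma bolzano_weierstrass (u : nat -> R[i]) (C : R) :
  (forall n, modulus (u n) <= C) ->
  exists z, forall e, 0 < e -> forall m, exists2 n, (m <= n)%N & modulus (u n - z) < e.
Proof.
move=> uC; pose v n : R * R := (complex.Re (u n), complex.Im (u n)).
have cK : compact (`[- C, C]%classic `*` `[- C, C]%classic : set (R * R)).
  by apply: compact_setX; exact: segment_compact.
have [|[a b] [_ cl]] := cK (v @ \oo) _.
  exists 0%N => // n _; split; rewrite /= in_itv/= -ler_norml.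
    by rewrite (le_trans (Re_le_modulus _)).
  by rewrite (le_trans (Im_le_modulus _)).
exists (a +i* b) => e e0 m.
have e2 : 0 < e / 2 by rewrite divr_gt0.
have := cl [set v n | n in [set n | (m <= n)%N]]
           [set p : R * R | `|a - p.1| < e / 2 /\ `|b - p.2| < e / 2].
case.
- by exists m => // n /= mn; exists n.
- exists (ball a (e / 2), ball b (e / 2)); first by split; exact: nbhsx_ballx.
  by move=> [p q] [].
- move=> _ [[n /= mn <-] [/= Ha Hb]]; exists n => //.
  rewrite (le_lt_trans (modulus_le_ReIm _))// [e]splitr.
  have -> : u n - (a +i* b) =
      (complex.Re (u n) - a) +i* (complex.Im (u n) - b) by case: (u n).
  by rewrite /= ltrD// distrC.
Qed.

End modulus_theory.

Lemma norm_lt (R : realType) (z : R[i]) (x : R) : (`|z| < x%:C) = (modulus z < x).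
Proof. by rewrite normE ltcR. Qed.

Lemma norm_lt1 (R : realType) (z : R[i]) : (`|z| < 1) = (modulus z < 1).
Proof. exact: norm_lt. Qed.

Lemma exp_small (R : realType) (A e r : R) : 0 <= r < 1 -> 0 < e ->
  exists m0, forall m, (m0 <= m)%N -> A * r ^+ m < e.
Proof.
move=> /andP[r0 r1] e0.
have := @cvg_expr R r; rewrite ger0_norm// => /(_ r1) /cvgrPdist_lt.
have A0 : 0 < `|A| + 1 by rewrite ltr_wpDl.
move=> /(_ (e / (`|A| + 1))); rewrite divr_gt0// => /(_ isT) [m0 _ Hm].
exists m0 => m /Hm /=; rewrite sub0r normrN normrX (ger0_norm r0).
rewrite ltr_pdivlMr// => H; apply: le_lt_trans H.
rewrite mulrC ler_wpM2l ?exprn_ge0// (le_trans (ler_norm _))// lerDl.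
exact: ler01.
Qed.

(** * Power series with bounded coefficients *)

(** Summed by components, so that convergence follows from the completeness of
    [R] alone. *)
HB.lock Definition power_series (R : realType) (c : nat -> R[i]) (z : R[i]) :
    R[i] :=
  limn (series (fun n => complex.Re (c n * z ^+ n))) +i*
  limn (series (fun n => complex.Im (c n * z ^+ n))).

Section power_series_theory.
Variable R : realType.
Implicit Types (c d : nat -> R[i]) (z w : R[i]) (C r : R).

Definition coef_bounded c C := forall n, modulus (c n) <= C.

Definition partial_sum c z m : R[i] := \sum_(n < m) c n * z ^+ n.

Lemma coef_bounded_ge0 c C : coef_bounded c C -> 0 <= C.
Proof. by move=> /(_ 0%N); apply: le_trans; exact: modulus_ge0. Qed.

Lemma partial_sumS c z m :
  partial_sum c z m.+1 = partial_sum c z m + c m * z ^+ m.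
Proof. exact: big_ord_recr. Qed.

Lemma partial_sum_recl c z m :
  partial_sum c z m.+1 = c 0%N + z * partial_sum (fun n => c n.+1) z m.
Proof.
rewrite /partial_sum big_ord_recl expr0 mulr1; congr (_ + _).
by rewrite mulr_sumr; apply: eq_bigr => i _; rewrite /= exprS mulrCA.
Qed.

Lemma partial_sum_dist c C z r m n : coef_bounded c C -> modulus z <= r -> r < 1 ->
  modulus (partial_sum c z (m + n) - partial_sum c z m) <= C * r ^+ m / (1 - r).
Proof.
move=> cC zr r1; have C0 := coef_bounded_ge0 cC.
have r0 : 0 <= r := le_trans (modulus_ge0 _) zr.
have r1' : 0 < 1 - r by rewrite subr_gt0.
have: modulus (partial_sum c z (m + n) - partial_sum c z m) <=
    C * r ^+ m * (1 - r ^+ n) / (1 - r).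
  elim: n => [|n IHn].
    by rewrite addn0 subrr modulus0 expr0 subrr mulr0 mul0r.
  rewrite addnS partial_sumS addrAC (le_trans (modulusD _ _))//.
  apply: (le_trans (lerD IHn (_ : _ <= C * r ^+ (m + n)))).
    rewrite modulusM modulusX ler_pM ?modulus_ge0 ?exprn_ge0 ?modulus_ge0//.
    by rewrite lerXn2r ?nnegrE ?modulus_ge0.
  rewrite le_eqVlt; apply/orP; left; apply/eqP; rewrite exprD [r ^+ n.+1]exprS.
  by field; rewrite gt_eqF.
move=> /le_trans; apply.
rewrite ler_wpM2r ?invr_ge0 ?(ltW r1')//.
by rewrite ler_piMr ?mulr_ge0 ?exprn_ge0// gerBl exprn_ge0.
Qed.

Lemma cvg_dominated (u : nat -> R) C r : 0 <= r < 1 -> 0 <= C ->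
  (forall n, `|u n| <= C * r ^+ n) -> cvgn (series u).
Proof.
move=> /andP[r0 r1] C0 uC; apply: normed_cvg.
apply: (series_le_cvg _ _ uC) => [n|n|]; rewrite ?mulr_ge0 ?exprn_ge0//.
by apply: is_cvg_geometric_series; rewrite ger0_norm.
Qed.

Lemma Re_sum (I : Type) (s : seq I) (F : I -> R[i]) :
  complex.Re (\sum_(i <- s) F i) = \sum_(i <- s) complex.Re (F i).
Proof. by apply: (big_morph (@complex.Re R)) => // -[a b] [a' b']. Qed.

Lemma Im_sum (I : Type) (s : seq I) (F : I -> R[i]) :
  complex.Im (\sum_(i <- s) F i) = \sum_(i <- s) complex.Im (F i).
Proof. by apply: (big_morph (@complex.Im R)) => // -[a b] [a' b']. Qed.

Lemma power_series_limit c C z e : coef_bounded c C -> modulus z < 1 -> 0 < e ->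
  exists m0, forall m, (m0 <= m)%N ->
    modulus (power_series c z - partial_sum c z m) < e.
Proof.
move=> cC z1 e0; have C0 := coef_bounded_ge0 cC.
have z01 : 0 <= modulus z < 1 by rewrite modulus_ge0.
have e2 : 0 < e / 2 by rewrite divr_gt0.
have termC n : modulus (c n * z ^+ n) <= C * modulus z ^+ n.
  by rewrite modulusM modulusX ler_wpM2r ?exprn_ge0 ?modulus_ge0.
have cRe : cvgn (series (fun n => complex.Re (c n * z ^+ n))).
  by apply: (cvg_dominated z01 C0) => n; exact: le_trans (Re_le_modulus _) _.
have cIm : cvgn (series (fun n => complex.Im (c n * z ^+ n))).
  by apply: (cvg_dominated z01 C0) => n; exact: le_trans (Im_le_modulus _) _.
have /cvgrPdist_lt/(_ _ e2)[m1 _ Hm1] := cRe.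
have /cvgrPdist_lt/(_ _ e2)[m2 _ Hm2] := cIm.
exists (maxn m1 m2) => m; rewrite geq_max => /andP[/Hm1/= h1 /Hm2/= h2].
rewrite power_series.unlock (le_lt_trans (modulus_le_ReIm _))// [e]splitr.
have ReB (a b : R[i]) : complex.Re (a - b) = complex.Re a - complex.Re b.
  by case: a b => ? ? [].
have ImB (a b : R[i]) : complex.Im (a - b) = complex.Im a - complex.Im b.
  by case: a b => ? ? [].
rewrite ReB ImB /partial_sum Re_sum Im_sum/= ltrD//.
  by rewrite -(big_mkord xpredT (fun n => complex.Re (c n * z ^+ n))).
by rewrite -(big_mkord xpredT (fun n => complex.Im (c n * z ^+ n))).
Qed.

Lemma power_series_error c C z r m : coef_bounded c C -> modulus z <= r -> r < 1 ->
  modulus (power_series c z - partial_sum c z m) <= C * r ^+ m / (1 - r).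
Proof.
move=> cC zr r1; apply/ler_addgt0Pr => e e0.
have [m0 Hm0] := power_series_limit cC (le_lt_trans zr r1) e0.
rewrite (le_trans (modulus_triangle (partial_sum c z (m + m0)) _ _))//.
rewrite addrC lerD ?partial_sum_dist//.
by rewrite ltW// Hm0// leq_addl.
Qed.

Lemma power_series_unique c C z s : coef_bounded c C -> modulus z < 1 ->
  (forall e, 0 < e -> exists m0, forall m, (m0 <= m)%N ->
     modulus (s - partial_sum c z m) < e) -> power_series c z = s.
Proof.
move=> cC z1 Hs; apply/eqP; rewrite -subr_eq0 -modulus_eq0.
rewrite eq_le modulus_ge0 andbT; apply/ler_addgt0Pr => e e0; rewrite add0r.
have e2 : 0 < e / 2 by rewrite divr_gt0.
have [m1 Hm1] := power_series_limit cC z1 e2.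
have [m2 Hm2] := Hs _ e2.
rewrite (le_trans (modulus_triangle (partial_sum c z (maxn m1 m2)) _ _))//.
rewrite [e]splitr lerD// ltW ?Hm1 ?leq_maxl//.
by rewrite modulusB Hm2 ?leq_maxr.
Qed.

Lemma power_series_unique_geometric c C z s A : coef_bounded c C -> modulus z < 1 ->
  (forall m, modulus (s - partial_sum c z m) <= A * modulus z ^+ m) ->
  power_series c z = s.
Proof.
move=> cC z1 Hs; apply: (power_series_unique cC z1) => e e0.
have [|m0 Hm0] := @exp_small _ A e (modulus z) _ e0; first by rewrite modulus_ge0.
by exists m0 => m /Hm0; apply: le_lt_trans.
Qed.

Lemma power_series_bound c C z : coef_bounded c C -> modulus z < 1 ->
  modulus (power_series c z) <= C / (1 - modulus z).
Proof.
move=> cC z1; have := power_series_error 0 cC (lexx (modulus z)) z1.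
by rewrite /partial_sum big_ord0 subr0 expr0 mulr1.
Qed.

Lemma power_series_recl c C z : coef_bounded c C -> modulus z < 1 ->
  power_series c z = c 0%N + z * power_series (fun n => c n.+1) z.
Proof.
move=> cC z1; have cC' : coef_bounded (fun n => c n.+1) C by move=> n; exact: cC.
have C0 := coef_bounded_ge0 cC.
apply: (power_series_unique_geometric
  (A := modulus (c 0%N + z * power_series (fun n => c n.+1) z) + C / (1 - modulus z)) cC z1) => -[|m].
  rewrite /partial_sum big_ord0 subr0 expr0 mulr1 lerDl.
  by rewrite divr_ge0// subr_ge0 ltW.
rewrite partial_sum_recl opprD addrACA subrr add0r -mulrBr modulusM.
have := power_series_error m cC' (lexx (modulus z)) z1.
move=> /(ler_wpM2l (modulus_ge0 z)) /le_trans; apply.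
rewrite mulrDl exprS ler_wpDl ?mulr_ge0 ?exprn_ge0 ?modulus_ge0//.
by rewrite le_eqVlt; apply/orP; left; apply/eqP; ring.
Qed.

Lemma power_seriesD c d C D z : coef_bounded c C -> coef_bounded d D ->
  modulus z < 1 ->
  power_series (fun n => c n + d n) z = power_series c z + power_series d z.
Proof.
move=> cC dD z1.
have cdCD : coef_bounded (fun n => c n + d n) (C + D).
  by move=> n; rewrite (le_trans (modulusD _ _))// lerD.
apply: (power_series_unique cdCD z1) => e e0.
have e2 : 0 < e / 2 by rewrite divr_gt0.
have [m1 H1] := power_series_limit cC z1 e2.
have [m2 H2] := power_series_limit dD z1 e2.
exists (maxn m1 m2) => m; rewrite geq_max => /andP[/H1 h1 /H2 h2].
have -> : partial_sum (fun n => c n + d n) z m = partial_sum c z m + partial_sum d z m.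
  by rewrite /partial_sum -big_split/=; apply: eq_bigr => i _; rewrite mulrDl.
rewrite opprD addrACA (le_lt_trans (modulusD _ _))// [e]splitr; exact: ltrD.
Qed.

Lemma power_seriesZ (a : R[i]) c C z : coef_bounded c C -> modulus z < 1 ->
  power_series (fun n => a * c n) z = a * power_series c z.
Proof.
move=> cC z1.
have acC : coef_bounded (fun n => a * c n) (modulus a * C).
  by move=> n; rewrite modulusM ler_wpM2l ?modulus_ge0.
apply: (power_series_unique_geometric (A := modulus a * (C / (1 - modulus z))) acC z1) => m.
have -> : partial_sum (fun n => a * c n) z m = a * partial_sum c z m.
  by rewrite /partial_sum mulr_sumr; apply: eq_bigr => i _; rewrite mulrA.
rewrite -mulrBr modulusM -mulrA ler_wpM2l ?modulus_ge0// mulrAC.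
exact: power_series_error.
Qed.

Lemma eq_power_series c d z : c =1 d -> power_series c z = power_series d z.
Proof. by move=> /funext ->. Qed.

Lemma partial_sum_poly c z m : partial_sum c z m = (\poly_(n < m) c n).[z].
Proof. by rewrite horner_poly. Qed.

End power_series_theory.

(** * Zeros of power series *)

Section zeros.
Variable R : realType.
Implicit Types (c d : nat -> R[i]) (z w : R[i]) (C r : R).

(** The coefficients of [(f - f w) / ('X - w)], where [f] is the series of [c]:
    long division by ['X - w] produces the tails of [f] at [w]. *)
Definition quotient c w (n : nat) : R[i] :=
  power_series (fun j => c (n.+1 + j)%N) w.

Lemma quotient_bounded c C w : coef_bounded c C -> modulus w < 1 ->
  coef_bounded (quotient c w) (C / (1 - modulus w)).
Proof. by move=> cC w1 n; apply: power_series_bound => // j; exact: cC. Qed.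

Lemma quotientE c C w z : coef_bounded c C -> modulus w < 1 -> modulus z < 1 ->
  power_series c z = power_series c w + (z - w) * power_series (quotient c w) z.
Proof.
move=> cC w1 z1.
pose T n := power_series (fun j => c (n + j)%N) w.
have shC n : coef_bounded (fun j => c (n + j)%N) C by move=> j; exact: cC.
have TC n : modulus (T n) <= C / (1 - modulus w) by exact: power_series_bound.
have TE n : T n = c n + w * T n.+1.
  rewrite /T (power_series_recl (shC n) w1) addn0; congr (_ + _ * _).
  by apply: eq_power_series => j; rewrite addSnnS.
have part m : partial_sum c z m =
    T 0%N + (z - w) * partial_sum (quotient c w) z m - T m * z ^+ m.
  elim: m => [|m IHm]; first by rewrite /partial_sum !big_ord0; ring.
  rewrite !partial_sumS IHm [T m]TE -[quotient c w m]/(T m.+1) exprS; ring.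
have qC := quotient_bounded cC w1.
rewrite -[power_series c w]/(T 0%N).
apply: (power_series_unique_geometric (A := modulus (z - w) *
  (C / (1 - modulus w) / (1 - modulus z)) + C / (1 - modulus w)) cC z1) => m.
rewrite part (_ : _ - _ = (z - w) * (power_series (quotient c w) z -
  partial_sum (quotient c w) z m) + T m * z ^+ m); last by ring.
rewrite (le_trans (modulusD _ _))// [leRHS]mulrDl lerD//.
  rewrite modulusM -mulrA ler_wpM2l ?modulus_ge0// mulrAC.
  exact: power_series_error.
by rewrite modulusM modulusX ler_wpM2r ?exprn_ge0 ?modulus_ge0.
Qed.

Lemma power_series_lipschitz c C r z w : coef_bounded c C -> r < 1 ->
  modulus z <= r -> modulus w <= r ->
  modulus (power_series c z - power_series c w) <=
    C / (1 - r) ^+ 2 * modulus (z - w).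
Proof.
move=> cC r1 zr wr; have C0 := coef_bounded_ge0 cC.
have z1 := le_lt_trans zr r1; have w1 := le_lt_trans wr r1.
have r0 : 0 < 1 - r by rewrite subr_gt0.
rewrite (quotientE cC w1 z1) addrC addKr modulusM mulrC ler_wpM2r ?modulus_ge0//.
apply: (le_trans (power_series_bound (quotient_bounded cC w1) z1)).
rewrite expr2 invfM mulrA ler_pM ?divr_ge0// ?subr_ge0 ?invr_ge0 ?subr_ge0 ?(ltW z1) ?(ltW w1)//.
  by rewrite ler_wpM2l// lef_pV2 ?posrE ?subr_gt0// lerB.
by rewrite lef_pV2 ?posrE ?subr_gt0// lerB.
Qed.

Lemma power_series_neq0_near c C w : coef_bounded c C -> modulus w < 1 ->
  power_series c w != 0 ->
  exists2 e, 0 < e & forall z, modulus z < 1 -> modulus (z - w) < e ->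
    power_series c z != 0.
Proof.
move=> cC w1 fw; have C0 := coef_bounded_ge0 cC.
pose r := (1 + modulus w) / 2.
have wr : modulus w < r by rewrite /r; lra.
have r1 : r < 1 by rewrite /r; lra.
pose K := C / (1 - r) ^+ 2 + 1.
have K0 : 0 < K by rewrite ltr_wpDl// divr_ge0 ?exprn_ge0// subr_ge0 ltW.
exists (Num.min (r - modulus w) (modulus (power_series c w) / K)).
  by rewrite lt_min subr_gt0 wr divr_gt0// modulus_gt0.
move=> z z1; rewrite lt_min => /andP[h1 h2].
have zr : modulus z <= r by have := modulus_dist z w; lra.
apply: contraTneq h2 => fz; rewrite -leNgt ler_pdivrMr// mulrC.
have := power_series_lipschitz cC r1 zr (ltW wr).
rewrite fz sub0r modulusN => /le_trans; apply.
by rewrite ler_wpM2r ?modulus_ge0// lerDl.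
Qed.

Definition accumulation_zero c w := forall e, 0 < e ->
  exists z, [/\ 0 < modulus (z - w) < e, modulus z < 1 & power_series c z = 0].

(** At an accumulation point of zeros one can divide by ['X - w] arbitrarily
    often; the coefficients of the [k]-th quotient grow at most like
    [(1 - |w|) ^- k], whence the radius of the disc. *)
Lemma accumulation_zero_disc c C w z : coef_bounded c C -> modulus w < 1 ->
  accumulation_zero c w -> modulus z < 1 -> modulus (z - w) < 1 - modulus w ->
  power_series c z = 0.
Proof.
move=> cC w1 acc z1 zw.
have factor k : exists2 d, coef_bounded d (C / (1 - modulus w) ^+ k) &
    forall x, modulus x < 1 -> power_series c x = (x - w) ^+ k * power_series d x.
  elim: k => [|k [d dC dE]].
    by exists c; [rewrite expr0 divr1|move=> x _; rewrite expr0 mul1r].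
  exists (quotient d w).
    by rewrite exprSr invfM mulrA; exact: quotient_bounded.
  have dw0 : power_series d w = 0.
    apply/eqP/negP => /negP dw; have [e e0 He] := power_series_neq0_near dC w1 dw.
    have [x [/andP[x0 xe] x1 fx]] := acc _ e0.
    have := He _ x1 xe; apply/negP; rewrite negbK.
    have := dE x x1; rewrite fx => /esym/eqP; rewrite mulf_eq0 => /orP[|//].
    by rewrite expf_eq0 => /andP[_]; rewrite -(modulus_eq0 (x - w)) gt_eqF.
  move=> x x1; rewrite dE// (quotientE dC w1 x1) dw0 add0r exprSr; ring.
pose q := modulus (z - w) / (1 - modulus w).
have w0 : 0 < 1 - modulus w by rewrite subr_gt0.
have q01 : 0 <= q < 1.
  by rewrite /q divr_ge0 ?modulus_ge0 ?(ltW w0)//= ltr_pdivrMr// mul1r.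
apply/eqP; rewrite -modulus_eq0 eq_le modulus_ge0 andbT.
apply/ler_addgt0Pr => e e0; rewrite add0r.
have [k /(_ k (leqnn k)) Hk] := @exp_small _ (C / (1 - modulus z)) e _ q01 e0.
have [d dC dE] := factor k.
rewrite dE// modulusM modulusX (le_trans _ (ltW Hk))//.
rewrite (le_trans (ler_wpM2l _ (power_series_bound dC z1))) ?exprn_ge0 ?modulus_ge0//.
rewrite /q expr_div_n le_eqVlt; apply/orP; left; apply/eqP.
by field; rewrite expf_neq0 ?gt_eqF ?subr_gt0.
Qed.

(** Walking towards the origin: the vanishing disc around an accumulation point
    contains another accumulation point, closer to [0] by a fixed amount, so
    that finitely many moves reach the origin. *)
Lemma zeros_isolated c C w : coef_bounded c C -> c 0%N != 0 -> modulus w < 1 ->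
  ~ accumulation_zero c w.
Proof.
move=> cC c0 w1; pose r := modulus w; pose dl := (1 - r) / 2.
have r1 : r < 1 by [].
have dl0 : 0 < dl by rewrite /dl; lra.
suff walk n x : modulus x <= r -> modulus x <= dl *+ n -> ~ accumulation_zero c x.
  have [n Hn] : exists n : nat, r <= dl *+ n.
    exists (Num.truncn (r / dl)).+1; rewrite -mulr_natl -ler_pdivrMr//.
    exact/ltW/truncnS_gt.
  exact: walk Hn.
elim: n x => [|n IHn] x xr xn acc.
  have x0 : x = 0 by apply/eqP; rewrite -modulus_eq0 eq_le modulus_ge0 xn.
  have := @accumulation_zero_disc c C x 0 cC; rewrite x0 modulus0 subrr modulus0.
  rewrite subr0 ltr01 x0 in acc * => /(_ isT acc isT isT)/eqP.
  by rewrite (power_series_recl cC) ?modulus0 ?ltr01// mul0r addr0 (negbTE c0).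
have x1 : modulus x < 1 := le_lt_trans xr r1.
(* Scaling by [t] brings a point within [dl *+ n.+1] of the origin to within
   [dl *+ n], and moves it by at most [dl]. *)
pose t : R := n%:R / n.+1%:R; pose y : R[i] := x * t%:C.
have n0 : (0 : R) < n.+1%:R by rewrite ltr0n.
have t0 : 0 <= t by rewrite divr_ge0.
have t1 : t <= 1 by rewrite ler_pdivrMr// mul1r ler_nat.
have yE : modulus y = modulus x * t by rewrite modulusM modulus_real ger0_norm.
have xy : modulus (y - x) <= dl.
  rewrite (_ : y - x = - (x * (1 - t)%:C)); last first.
    by rewrite rmorphB rmorph1 /y; ring.
  rewrite modulusN modulusM modulus_real ger0_norm ?subr_ge0//.
  have -> : 1 - t = n.+1%:R^-1.
    by rewrite /t -natr1; field; rewrite natr1 gt_eqF.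
  by rewrite ler_pdivrMr// mulr_natr.
have yr : modulus y <= r by rewrite yE (le_trans _ xr)// ler_piMr ?modulus_ge0.
apply: (IHn y) => //.
  rewrite yE /t mulrA ler_pdivrMr// -[dl *+ n]mulr_natr mulrAC [dl * _]mulr_natr.
  by rewrite ler_wpM2r.
move=> e e0.
pose e' := Num.min (e / 2) ((1 - modulus x - modulus (y - x)) / 2).
have sp : 0 < 1 - modulus x - modulus (y - x) by rewrite /dl -/r in xy *; lra.
have e'0 : 0 < e' by rewrite lt_min !divr_gt0.
have e'e : e' <= e / 2 by rewrite /e' ge_min lexx.
have e's : e' <= (1 - modulus x - modulus (y - x)) / 2 by rewrite /e' ge_min lexx orbT.
have zy : modulus (y + e'%:C - y) = e' by rewrite addrC addKr modulus_real ger0_norm ?ltW.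
have zx : modulus (y + e'%:C - x) < 1 - modulus x.
  by rewrite (le_lt_trans (modulus_triangle y _ _))// zy; lra.
have z1 : modulus (y + e'%:C) < 1.
  by have := modulus_dist (y + e'%:C) x; lra.
exists (y + e'%:C); split => //; first by rewrite zy e'0; lra.
exact: accumulation_zero_disc zx.
Qed.

End zeros.

(** * Persistence of zeros *)

Section persistence.
Variable R : realType.
Implicit Types (c d : nat -> R[i]) (z w : R[i]) (C r : R) (p : {poly R[i]}).

(** A special case of Rouche's theorem by pure algebra.  If all the roots [a] of
    [p] are outside the disc then, for [N] large, the product of the values of
    [p] at the [N] points [w + x] with [x ^+ N = rho ^+ N] is, up to sign, the
    product of [lead_coef p ^+ N] and of the [(a - w) ^+ N - rho ^+ N].  Each of the
    latter has modulus at most [2 * |a - w| ^+ N], hence the whole product has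
    modulus at most [2 ^+ deg p * |p w| ^+ N]. *)
Lemma poly_root_disc p w (rho dl : R) : 0 < rho -> 0 < dl ->
  (forall z, modulus (z - w) = rho -> dl <= modulus p.[z]) ->
  modulus p.[w] < dl / 2 ->
  exists2 z, modulus (z - w) <= rho & root p z.
Proof.
move=> rho0 dl0 circ pw; apply: contrapT => noroot.
have [rs pE] := closed_field_poly_normal p.
have p0 : p != 0.
  apply/eqP => p0; have := circ (w + rho%:C); rewrite p0 horner0 modulus0.
  by rewrite addrC addKr modulus_real gtr0_norm// => /(_ erefl); rewrite leNgt dl0.
have out a : a \in rs -> rho < modulus (a - w).
  move=> ars; rewrite ltNge; apply/negP => arho; apply: noroot; exists a => //.
  by rewrite pE rootZ ?lead_coef_eq0// root_prod_XsubC.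
(* One more than the degree [d], so that [2 ^+ d * (dl / 2) ^+ N < dl ^+ N]. *)
pose N := (size rs).+1.
have [ws] := closed_field_poly_normal ('X^N - (rho ^+ N)%:C%:P : {poly R[i]}).
rewrite (monicP _); last by rewrite monicXnsubC.
rewrite scale1r => wsE.
have sws : size ws = N.
  have := congr1 (fun q : {poly _} => size q) wsE.
  by rewrite size_prod_XsubC size_XnsubC// => -[].
have wsrho x : x \in ws -> modulus x = rho.
  rewrite -root_prod_XsubC -wsE => /rootP.
  rewrite !hornerE => /eqP; rewrite subr_eq0 => /eqP xN.
  apply/eqP; rewrite -(@eqrXn2 _ N)// ?modulus_ge0 ?(ltW rho0)//.
  by rewrite -modulusX xN modulus_real ger0_norm// exprn_ge0 ?ltW.
have lower : dl ^+ N <= \prod_(x <- ws) modulus p.[w + x].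
  have -> : dl ^+ N = \prod_(x <- ws) dl.
    by rewrite big_const_seq count_predT sws iter_mulr_1.
  rewrite big_seq [leRHS]big_seq; apply: ler_prod => x /wsrho xr.
  by rewrite ltW//= circ// addrC addKr.
have pval x : modulus p.[x] = modulus (lead_coef p) * \prod_(a <- rs) modulus (a - x).
  rewrite {1}pE hornerZ modulusM horner_prod modulus_prod; congr (_ * _).
  by apply: eq_bigr => a _; rewrite !hornerE modulusB.
have factor a : \prod_(x <- ws) modulus (a - (w + x)) =
    modulus ((a - w) ^+ N - (rho ^+ N)%:C).
  have := congr1 (fun q : {poly _} => modulus q.[a - w]) wsE.
  rewrite /= horner_prod modulus_prod !hornerE => ->.
  by apply: eq_bigr => x _; rewrite !hornerE opprD addrA.
have upper : \prod_(x <- ws) modulus p.[w + x] <=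
    2 ^+ (size rs) * modulus p.[w] ^+ N.
  under eq_bigr do rewrite pval.
  rewrite big_split/= exchange_big/= pval exprMn mulrCA.
  rewrite big_const_seq count_predT sws iter_mulr_1.
  rewrite ler_wpM2l ?exprn_ge0 ?modulus_ge0//.
  rewrite -prodrXl -[2 ^+ _]iter_mulr_1 -(count_predT rs) -big_const_seq -big_split/=.
  rewrite big_seq [leRHS]big_seq; apply: ler_prod => a ars.
  rewrite factor modulus_ge0/= mulr2n mulrDl mul1r.
  rewrite (le_trans (modulusD _ _))// modulusN modulusX lerD2l.
  rewrite modulus_real ger0_norm ?exprn_ge0 ?(ltW rho0)//.
  by rewrite lerXn2r ?nnegrE ?modulus_ge0 ?(ltW rho0)// ltW// out.
have : 2 ^+ (size rs) * modulus p.[w] ^+ N < dl ^+ N.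
  have : modulus p.[w] ^+ N < (dl / 2) ^+ N.
    by rewrite ltrXn2r// ?modulus_ge0// divr_ge0// ltW.
  rewrite -(ltr_pM2l (exprn_gt0 (size rs) (ltr0n R 2))) => /lt_le_trans; apply.
  rewrite expr_div_n mulrCA ler_piMr ?exprn_ge0 ?(ltW dl0)//.
  by rewrite ler_pdivrMr ?exprn_gt0// mul1r ler_eXn2l ?ltr1n.
by rewrite ltNge (le_trans lower upper).
Qed.

Lemma power_series_min c C r (K : R[i] -> Prop) : coef_bounded c C -> r < 1 ->
  (forall z, K z -> modulus z <= r) ->
  (forall z, (forall e, 0 < e -> exists2 x, K x & modulus (x - z) < e) -> K z) ->
  (forall z, K z -> power_series c z != 0) ->
  exists2 dl, 0 < dl & forall z, K z -> dl <= modulus (power_series c z).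
Proof.
move=> cC r1 Kr Kcl K0; apply: contrapT => noinf.
have /choice[u uP] n : exists z, K z /\ modulus (power_series c z) < n.+1%:R^-1.
  apply: contrapT => H; apply: noinf; exists n.+1%:R^-1.
    by rewrite invr_gt0 ltr0n.
  move=> z Kz; rewrite leNgt; apply/negP => Hz; apply: H; by exists z.
have ur n : modulus (u n) <= r by apply: Kr; case: (uP n).
have [z zP] := bolzano_weierstrass ur.
have Kz : K z.
  apply: Kcl => e e0; have [n _ Hn] := zP e e0 0%N.
  by exists (u n) => //; case: (uP n).
have z1 := le_lt_trans (Kr _ Kz) r1.
have /eqP := K0 _ Kz; apply.
apply/eqP; rewrite -modulus_eq0 eq_le modulus_ge0 andbT.
apply/ler_addgt0Pr => e e0; rewrite add0r.
pose L := C / (1 - r) ^+ 2 + 1.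
have L0 : 0 < L.
  by rewrite ltr_wpDl// divr_ge0 ?exprn_ge0 ?(coef_bounded_ge0 cC)// subr_ge0 ltW.
have e2 : 0 < e / 2 by rewrite divr_gt0.
have [n] := zP (e / 2 / L) (divr_gt0 e2 L0) (Num.truncn (2 / e)).
move=> nlarge; rewrite ltr_pdivlMr// => unz.
have [_ un0] := uP n.
apply: ltW; apply: (le_lt_trans (modulus_dist _ (power_series c (u n)))).
rewrite [e]splitr ltrD//.
  apply: (lt_trans un0); rewrite invf_plt ?posrE ?ltr0n// invf_div.
  by rewrite (lt_le_trans (truncnS_gt _))// ler_nat ltnS.
apply: le_lt_trans unz.
apply: le_trans (power_series_lipschitz cC r1 (Kr _ Kz) (ur n)) _.
by rewrite modulusB mulrC ler_wpM2l ?modulus_ge0// lerDl.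
Qed.

(** Hurwitz's theorem for the family of all series whose coefficients have a
    common bound, where closeness means agreement of many coefficients.  The
    truncations have a zero in the disc by [poly_root_disc], hence so does their
    uniform limit. *)
Theorem zero_persists c C w e : coef_bounded c C -> c 0%N != 0 -> modulus w < 1 ->
  power_series c w = 0 -> 0 < e ->
  exists m, forall d, coef_bounded d C -> (forall n, (n < m)%N -> d n = c n) ->
    exists z, [/\ modulus (z - w) < e, modulus z < 1 & power_series d z = 0].
Proof.
move=> cC c0 w1 fw e0; have C0 := coef_bounded_ge0 cC.
have /existsNP[e1 /not_implyP[e10 Hiso]] := zeros_isolated cC c0 w1.
pose rho := Num.min (Num.min e e1) (1 - modulus w) / 2.
have rho0 : 0 < rho by rewrite divr_gt0// !lt_min e0 e10 subr_gt0.
have [rhoe [rhoe1 rhow]] : rho < e /\ rho < e1 /\ modulus w + rho < 1.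
  have h1 : Num.min (Num.min e e1) (1 - modulus w) <= e by rewrite !ge_min lexx.
  have h2 : Num.min (Num.min e e1) (1 - modulus w) <= e1 by rewrite !ge_min lexx orbT.
  have h3 : Num.min (Num.min e e1) (1 - modulus w) <= 1 - modulus w.
    by rewrite ge_min lexx orbT.
  rewrite /rho; split; first lra. split; lra.
pose r := modulus w + rho.
have disc z : modulus (z - w) <= rho -> modulus z <= r.
  by have := modulus_dist z w; rewrite /r; lra.
have closeC z x : modulus (z - w) <= modulus (x - w) + modulus (x - z).
  by rewrite [leRHS]addrC [modulus (x - z)]modulusB modulus_triangle.
have closeC' z x : modulus (x - w) <= modulus (z - w) + modulus (x - z).
  by rewrite [leRHS]addrC modulus_triangle.
have [dl dl0 Hdl] : exists2 dl, 0 < dl &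
    forall z, modulus (z - w) = rho -> dl <= modulus (power_series c z).
  apply: (power_series_min cC rhow) => [z Hz|z Hz|z Hz].
  - by apply: disc; rewrite Hz.
  - apply: le_anti; apply/andP; split; apply/ler_addgt0Pr => a a0.
      by have [x xr xz] := Hz _ a0; have := closeC z x; lra.
    by have [x xr xz] := Hz _ a0; have := closeC' z x; lra.
  - apply/eqP => fz; apply: Hiso; exists z; split => //.
      by rewrite Hz rho0.
    by rewrite (le_lt_trans (disc _ _) rhow)// Hz.
have r01 : 0 <= r < 1 by rewrite rhow andbT addr_ge0 ?modulus_ge0// ltW.
have [m Hm] := @exp_small _ (C / (1 - r)) (dl / 16) _ r01 (divr_gt0 dl0 (ltr0n _ 16)).
exists m => d dC dc.
(* The tails of both series are below [dl / 16], and three of them intervene;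
   thus the truncations exceed [3 / 4 * dl] on the circle and are below
   [dl / 4] at the centre. *)
have near z k : (m <= k)%N -> modulus z <= r ->
    modulus (partial_sum d z k - power_series c z) < dl / 4.
  move=> mk zr.
  have err b j : coef_bounded b C -> (m <= j)%N ->
      modulus (power_series b z - partial_sum b z j) < dl / 16.
    move=> bC mj; apply: le_lt_trans (power_series_error j bC zr rhow) _.
    by rewrite mulrAC Hm.
  have H1 := err c m cC (leqnn m).
  have H2 := err d m dC (leqnn m).
  have H3 := err d k dC mk.
  have E : partial_sum d z m = partial_sum c z m.
    by apply: eq_bigr => i _; rewrite dc.
  have := modulus_triangle (power_series d z) (partial_sum d z k) (power_series c z).
  have := modulus_triangle (partial_sum c z m) (power_series d z) (power_series c z).
  rewrite E in H2; move: H1 H2 H3; rewrite modulusB [modulus (power_series d z - partial_sum d z k)]modulusB.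
  by move=> *; lra.
have roots k : (m <= k)%N ->
    exists2 z, modulus (z - w) <= rho & partial_sum d z k = 0.
  move=> mk; have wr : modulus w <= r by rewrite lerDl ltW.
  have [|z zr||z zw /rootP z0] :=
      @poly_root_disc (\poly_(n < k) d n) w rho (3 / 4 * dl) rho0.
  - by rewrite mulr_gt0// divr_gt0.
  - rewrite -partial_sum_poly.
    have := near z k mk (disc z ltac:(by rewrite zr)).
    have := modulus_dist (power_series c z) (partial_sum d z k).
    have := Hdl z zr; rewrite [modulus (power_series c z - _)]modulusB.
    lra.
  - rewrite -partial_sum_poly.
    by have := near w k mk wr; rewrite fw subr0; lra.
  - by exists z; rewrite // partial_sum_poly.
apply: contrapT => nozero.
have [dl' dl'0 Hdl'] : exists2 dl', 0 < dl' &
    forall z, modulus (z - w) <= rho -> dl' <= modulus (power_series d z).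
  apply: (power_series_min dC rhow) => [z Hz|z Hz|z Hz].
  - exact: disc.
  - apply/ler_addgt0Pr => a a0.
    by have [x xr xz] := Hz _ a0; have := closeC z x; lra.
  - apply/eqP => fz; apply: nozero; exists z; split => //.
      exact: le_lt_trans rhoe.
    exact: le_lt_trans (disc _ Hz) rhow.
have [k0 Hk0] := @exp_small _ (C / (1 - r)) dl' _ r01 dl'0.
have [z zw Pz] := roots (maxn m k0) (leq_maxl _ _).
have := power_series_error (maxn m k0) dC (disc _ zw) rhow.
rewrite Pz subr0 mulrAC => /le_lt_trans/(_ (Hk0 _ (leq_maxr _ _))).
by rewrite ltNge Hdl'.
Qed.

End persistence.

(** * The orbit of 1 and its one-sided limits *)

Section orbit.
Variable R : realType.
Implicit Types (b x : R) (a : nat -> int).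

Definition orbit b n : R := iter n (beta_map b) 1.

(** The orbit of [1] under the map whose branches are closed on the right, i.e.
    the limit of [orbit x] as [x] increases to [b]. *)
Definition orbit_left b n : R :=
  iter n (fun x => b * x - (Num.ceil (b * x) - 1)%:~R) 1.

Definition digit_left b n : int := Num.ceil (b * orbit_left b n) - 1.

Lemma orbitS b n : orbit b n.+1 = b * orbit b n - (digit b 1 n.+1)%:~R.
Proof. by []. Qed.

Lemma orbit_leftS b n :
  orbit_left b n.+1 = b * orbit_left b n - (digit_left b n)%:~R.
Proof. by []. Qed.

Lemma digitE b n : digit b 1 n.+1 = Num.floor (b * orbit b n).
Proof. by []. Qed.

Lemma orbitS_ge0 b n : 0 <= orbit b n.+1.
Proof. by rewrite orbitS subr_ge0 digitE floor_le. Qed.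

Lemma orbitS_lt1 b n : orbit b n.+1 < 1.
Proof. by rewrite orbitS ltrBlDr addrC -[1]/(1%:~R) -intrD digitE floorD1_gt. Qed.

Lemma orbit_ge0 b n : 0 <= orbit b n.
Proof. by case: n => [|n]; [exact: ler01|exact: orbitS_ge0]. Qed.

Lemma orbit_le1 b n : orbit b n <= 1.
Proof. by case: n => // n; exact/ltW/orbitS_lt1. Qed.

Lemma digit_ge0 b n : 0 <= b -> 0 <= digit b 1 n.
Proof.
by move=> b0; rewrite /digit floor_ge0 mulr_ge0// -[iter _ _ _]/(orbit b _) orbit_ge0.
Qed.

Lemma digit_le b n : 0 <= b -> (digit b 1 n)%:~R <= b.
Proof.
move=> b0; rewrite (le_trans (floor_le _))// ler_piMr//.
by rewrite -[iter _ _ _]/(orbit b _) orbit_le1.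
Qed.

Lemma orbit_left_gt0 b n : 0 < orbit_left b n.
Proof.
case: n => [|n]; first exact: ltr01.
by rewrite orbit_leftS subr_gt0 ceilB1_lt.
Qed.

Lemma orbit_left_le1 b n : orbit_left b n <= 1.
Proof.
case: n => [|n]; first exact: lexx.
rewrite orbit_leftS /digit_left lerBlDr addrC -[X in _ + X]/(1%:~R) -intrD subrK.
exact: ceil_ge.
Qed.

Lemma digit_left_ge0 b n : 0 < b -> 0 <= digit_left b n.
Proof.
move=> b0; rewrite /digit_left subr_ge0 -gtz0_ge1 ceil_gt0.
by rewrite mulr_gt0// orbit_left_gt0.
Qed.

Lemma digit_left_le b n : 0 < b -> (digit_left b n)%:~R <= b.
Proof.
move=> b0; rewrite (le_trans (ltW (ceilB1_lt _)))// ler_piMr ?orbit_left_le1//.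
exact: ltW.
Qed.

Lemma orbit_absorbed b m n : orbit b m = 0 -> (m <= n)%N -> orbit b n = 0.
Proof.
move=> bm /subnKC <-; elim: (n - m)%N => [|j IHj]; first by rewrite addn0.
by rewrite addnS orbitS digitE IHj mulr0 floor0 subr0.
Qed.

Lemma digit_absorbed b m n : orbit b m = 0 -> (m <= n)%N -> digit b 1 n.+1 = 0.
Proof. by move=> bm mn; rewrite digitE (orbit_absorbed bm mn) mulr0 floor0. Qed.

(** With prescribed digits [a] the orbit is a polynomial in the parameter, which
    gives access to its continuity and to the intermediate value theorem. *)
Fixpoint orbit_poly a n : {poly R} :=
  if n is m.+1 then 'X * orbit_poly a m - (a m)%:~R%:P else 1.

Lemma orbit_polyE a b n : (forall i, (i < n)%N -> digit b 1 i.+1 = a i) ->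
  orbit b n = (orbit_poly a n).[b].
Proof.
elim: n => [|n IHn] ba; first by rewrite hornerC.
rewrite orbitS ba// IHn; last by move=> i ni; rewrite ba// ltnW.
by rewrite /= !hornerE.
Qed.

Lemma orbit_left_polyE b n : orbit_left b n = (orbit_poly (digit_left b) n).[b].
Proof.
elim: n => [|n IHn]; first by rewrite hornerC.
by rewrite orbit_leftS IHn /= !hornerE.
Qed.

(** As long as the digits agree, a difference of the parameters is created in the
    first step and then multiplied by at least [b] in each further one. *)
Lemma orbit_expand b x n : 1 < b -> b <= x ->
  (forall i, (i < n)%N -> digit x 1 i.+1 = digit b 1 i.+1) ->
  orbit b n <= orbit x n /\
  ((0 < n)%N -> b ^+ n.-1 * (x - b) <= orbit x n - orbit b n).
Proof.
move=> b1 bx; have b0 : 0 < b := lt_trans ltr01 b1.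
elim: n => [|n IHn] same; first by [].
have [|le dist] := IHn; first by move=> i ni; rewrite same// ltnW.
have E : orbit x n.+1 - orbit b n.+1 =
    b * (orbit x n - orbit b n) + (x - b) * orbit x n.
  by rewrite !orbitS same//; ring.
have H : b ^+ n * (x - b) <= orbit x n.+1 - orbit b n.+1.
  rewrite E; case: n dist {E IHn same} le => [|n] dist le.
    by rewrite expr0 mul1r subrr mulr0 add0r mulr1.
  rewrite exprS -mulrA ler_wpDr ?mulr_ge0 ?orbit_ge0 ?subr_ge0//.
  by rewrite ler_wpM2l ?(ltW b0)// dist.
split=> // ; rewrite -subr_ge0 (le_trans _ H)// mulr_ge0 ?exprn_ge0 ?subr_ge0//.
exact: ltW.
Qed.

Lemma digit_right b m : 1 < b -> \forall x \near b, b <= x ->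
  forall i, (i < m)%N -> digit x 1 i.+1 = digit b 1 i.+1.
Proof.
move=> b1; elim: m => [|m IHm]; first by near=> x.
pose a i := digit b 1 i.+1; pose p := 'X * orbit_poly a m.
have pb : p.[b] = b * orbit b m by rewrite /p !hornerE -(@orbit_polyE a).
have near1 : \forall x \near b, p.[x] < (a m + 1)%:~R.
  have : p.[b] < (a m + 1)%:~R by rewrite pb /a digitE floorD1_gt.
  exact: (cvgr_lt _ (@continuous_horner R p b)).
near=> x => bx i.
have same : forall j, (j < m)%N -> digit x 1 j.+1 = digit b 1 j.+1.
  by move: bx; near: x.
rewrite ltnS leq_eqVlt => /orP[/eqP->|/same//].
rewrite digitE; apply: floor_def; rewrite (orbit_polyE same) -/a.
have -> : x * (orbit_poly a m).[x] = p.[x] by rewrite /p !hornerE.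
apply/andP; split; last by near: x.
rewrite /p !hornerE -(orbit_polyE same) (le_trans (floor_le _))//.
have [le _] := orbit_expand b1 bx same.
by rewrite ler_pM ?orbit_ge0// ltW// (lt_trans _ b1).
Unshelve. all: by end_near. Qed.

Lemma digit_near_left b m : 1 < b -> \forall x \near b, x < b ->
  forall i, (i < m)%N -> digit x 1 i.+1 = digit_left b i.
Proof.
move=> b1; have b0 : 0 < b := lt_trans ltr01 b1.
suff: \forall x \near b, x < b -> orbit x m <= orbit_left b m /\
    forall i, (i < m)%N -> digit x 1 i.+1 = digit_left b i.
  by apply: filterS => x H /H[].
elim: m => [|m IHm]; first by near=> x.
pose a := digit_left b; pose p := 'X * orbit_poly a m.
have pb : p.[b] = b * orbit_left b m by rewrite /p !hornerE -orbit_left_polyE.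
have near1 : \forall x \near b, (a m)%:~R < p.[x].
  have : (a m)%:~R < p.[b] by rewrite pb /a ceilB1_lt.
  exact: (cvgr_gt _ (@continuous_horner R p b)).
near=> x => xb.
have x0 : 0 < x by near: x; exact: lt_nbhsr.
have [le same] : orbit x m <= orbit_left b m /\
    forall i, (i < m)%N -> digit x 1 i.+1 = digit_left b i.
  by move: xb; near: x.
have px : p.[x] = x * orbit x m by rewrite /p !hornerE (orbit_polyE same).
have lt : x * orbit x m < b * orbit_left b m.
  apply: (le_lt_trans (ler_wpM2l (ltW x0) le)).
  by rewrite ltr_pM2r// orbit_left_gt0.
have dm : digit x 1 m.+1 = digit_left b m.
  rewrite digitE; apply: floor_def; rewrite -px; apply/andP; split.
    by rewrite ltW//; near: x.
  by rewrite px (lt_le_trans lt)// /digit_left subrK ceil_ge.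
split=> [|i].
  by rewrite orbitS orbit_leftS dm lerD2r ltW.
by rewrite ltnS leq_eqVlt => /orP[/eqP->|/same].
Unshelve. all: by end_near. Qed.

End orbit.

(** * The series [1 - phi] and its zeros *)

Section beta_series.
Variable R : realType.
Implicit Types (b x : R) (z w : R[i]).

Definition beta_coef b n : R[i] :=
  if n is 0%N then 1 else - (digit b 1 n)%:~R%:C.

Definition beta_coef_left b n : R[i] :=
  if n is m.+1 then - (digit_left b m)%:~R%:C else 1.

Definition beta_series b z := power_series (beta_coef b) z.

Lemma beta_coef_bounded b C : 1 < b -> b <= C -> coef_bounded (beta_coef b) C.
Proof.
move=> b1 bC; have b0 := ltW (lt_trans ltr01 b1); case=> [|n].
  by rewrite modulus1 (le_trans (ltW b1)).
rewrite modulusN modulus_real ger0_norm ?ler0z ?digit_ge0//.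
by rewrite (le_trans (digit_le _ _)).
Qed.

Lemma beta_coef_left_bounded b C : 1 < b -> b <= C ->
  coef_bounded (beta_coef_left b) C.
Proof.
move=> b1 bC; have b0 := lt_trans ltr01 b1; case=> [|n].
  by rewrite modulus1 (le_trans (ltW b1)).
rewrite modulusN modulus_real ger0_norm ?ler0z ?digit_left_ge0//.
by rewrite (le_trans (digit_left_le _ _)).
Qed.

Lemma phi_beta_series b z : 1 < b -> `|z| < 1 ->
  1 - phi b (b%:C * z) = beta_series b z.
Proof.
move=> b1; rewrite norm_lt1 => z1; rewrite phi_beta ?gt_eqF ?(lt_trans ltr01)//.
set u := (fun m : nat => _); suff -> : limn u = 1 - beta_series b z.
  by rewrite opprB addrC subrK.
apply: cvg_lim; first exact: norm_hausdorff.
apply/cvgrPdist_lt => e; rewrite ltcE => /andP[/eqP/= Ie Re0].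
have eE : e = (complex.Re e)%:C by case: e Ie {Re0} => ? ? /= ->.
have [m0 Hm0] := power_series_limit (beta_coef_bounded b1 (lexx b)) z1 Re0.
near=> m; rewrite eE norm_lt.
have m0m : (m0 < m)%N by near: m; exact: nbhs_infty_gt.
have -> : 1 - beta_series b z - u m =
    - (beta_series b z - partial_sum (beta_coef b) z m).
  rewrite -(ltn_predK m0m); move: m.-1 => k.
  rewrite partial_sum_recl /= /u big_add1 big_mkord/=.
  rewrite (_ : z * _ = - \sum_(i < k) (digit b 1 i.+1)%:~R%:C * z ^+ i.+1); first by ring.
  rewrite /partial_sum mulr_sumr -sumrN; apply: eq_bigr => i _.
  by rewrite exprS; ring.
by rewrite modulusN Hm0// ltnW.
Unshelve. all: by end_near. Qed.

Lemma beta_series_inv b : 1 < b -> beta_series b (b^-1)%:C = 0.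
Proof.
move=> b1; have b0 : 0 < b := lt_trans ltr01 b1.
have bi : modulus (b^-1)%:C = b^-1 by rewrite modulus_real gtr0_norm ?invr_gt0.
have bi1 : modulus (b^-1)%:C < 1 by rewrite bi invf_lt1.
apply: (power_series_unique_geometric (A := b)
  (beta_coef_bounded b1 (lexx b)) bi1) => -[|m].
  by rewrite /partial_sum big_ord0 subrr modulus0 expr0 mulr1 ltW.
have -> : partial_sum (beta_coef b) (b^-1)%:C m.+1 = (orbit b m / b ^+ m)%:C.
  elim: m => [|m IHm].
    by rewrite /partial_sum big_ord1 !expr0 divr1 mulr1.
  rewrite partial_sumS IHm -[beta_coef b m.+1]/(- (digit b 1 m.+1)%:~R%:C).
  rewrite -rmorphXn -rmorphN -rmorphM -rmorphD; congr _%:C.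
  by rewrite orbitS exprVn exprS; field; rewrite expf_neq0 ?gt_eqF.
rewrite sub0r modulusN bi modulus_real ger0_norm; last first.
  by rewrite divr_ge0 ?orbit_ge0 ?exprn_ge0 ?ltW.
rewrite exprVn exprS invfM mulrA divff ?gt_eqF// mul1r.
by rewrite ler_piMl ?orbit_le1// invr_ge0 exprn_ge0 ?ltW.
Qed.

Lemma power_series_shift (c : nat -> R[i]) C z k : coef_bounded c C ->
  modulus z < 1 ->
  power_series (fun n => if (n < k)%N then 0 else c (n - k)%N) z =
  z ^+ k * power_series c z.
Proof.
move=> cC z1; have C0 := coef_bounded_ge0 cC.
elim: k => [|k IHk].
  by rewrite expr0 mul1r; apply: eq_power_series => n; rewrite subn0.
rewrite (@power_series_recl _ _ C)//= ?add0r ?exprS -?mulrA -?IHk; last first.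
  by move=> n; case: ifP => _; rewrite ?modulus0.
by congr (_ * _); apply: eq_power_series => n; rewrite ltnS subSS.
Qed.

(** If the orbit of [1] reaches [0] for the first time after [m] steps, the
    digits from the left repeat with period [m], so that the two series differ
    by the factor [1 - z ^+ m]; otherwise they coincide. *)
Lemma beta_series_left_zero b z : 1 < b -> modulus z < 1 ->
  beta_series b z = 0 -> power_series (beta_coef_left b) z = 0.
Proof.
move=> b1 z1 fz; have b0 : 0 < b := lt_trans ltr01 b1.
have same n : (forall i, (i <= n)%N -> orbit b i.+1 != 0) ->
    orbit_left b n.+1 = orbit b n.+1 /\ digit_left b n = digit b 1 n.+1.
  elim: n => [|n IHn] nz.
    have := nz 0%N isT; rewrite orbitS orbit_leftS /digit_left digitE.
    rewrite ceil_floor.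
    case: (boolP (_ \is a Num.int)) => [|_ _]; last by rewrite addrK.
    by rewrite intrEfloor => /eqP ->; rewrite subrr eqxx.
  have [|E _] := IHn; first by move=> i ni; apply: nz; exact: leqW.
  have := nz n.+1 (leqnn _); rewrite orbitS orbit_leftS /digit_left digitE E.
  rewrite ceil_floor.
  case: (boolP (_ \is a Num.int)) => [|_ _]; last by rewrite addrK.
  by rewrite intrEfloor => /eqP ->; rewrite subrr eqxx.
have [nz|] := pselect (forall i, orbit b i.+1 != 0).
  rewrite -[RHS]fz; apply: eq_power_series => -[//|n] /=.
  by have [_ ->] := same n (fun i _ => nz i).
move=> /existsNP[m0 /negP/negPn m0P].
have [m /eqP m_zero m_min] := ex_minnP (ex_intro (fun i => orbit b i.+1 == 0) _ m0P).
have nz i : (i < m)%N -> orbit b i.+1 != 0.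
  by move=> im; apply/negP => /m_min; rewrite leqNgt im.
have same' i : (i <= m)%N -> orbit_left b i = orbit b i.
  case: i => [//|i] im; have [] := same i => // j ji.
  by apply: nz; exact: leq_ltn_trans im.
have dm : digit_left b m = digit b 1 m.+1 - 1.
  rewrite /digit_left digitE same'//; congr (_ - _).
  have : b * orbit b m \is a Num.int.
    rewrite intrEfloor eq_sym -subr_eq0 -[X in X == 0]/(orbit b m.+1).
    by rewrite m_zero.
  by rewrite ceil_floor => ->; rewrite addr0.
have om : orbit_left b m.+1 = 1.
  rewrite orbit_leftS dm same'// intrB opprB addrCA addrC -orbitS m_zero.
  by rewrite add0r.
have period j : orbit_left b (m.+1 + j) = orbit_left b j.
  elim: j => [|j IHj]; first by rewrite addn0 om.
  by rewrite addnS [LHS]orbit_leftS [RHS]orbit_leftS /digit_left IHj.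
have split_coef n : beta_coef_left b n = beta_coef b n +
    (if (n < m.+1)%N then 0 else beta_coef_left b (n - m.+1)).
  case: ltnP => [|mn].
    case: n => [|n]; first by rewrite addr0.
    rewrite ltnS addr0 /= => nm; have [] := same n => [i ni|_ -> //].
    by apply: nz; exact: leq_ltn_trans nm.
  case: n mn => [//|n]; rewrite ltnS subSS leq_eqVlt => /orP[/eqP <-|mn].
    by rewrite subnn /= dm intrB rmorphB opprB addrC.
  rewrite -(subnKC mn) -[(m.+1 + _ - m)%N]/((m.+1 + _ - m)%N) addSnnS addKn.
  rewrite -addSnnS /= (digit_absorbed m_zero) ?leq_addr// oppr0 add0r /digit_left.
  by rewrite period.
have cC := beta_coef_bounded b1 (lexx b).
have cC' := beta_coef_left_bounded b1 (lexx b).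
have E : power_series (beta_coef_left b) z =
    z ^+ m.+1 * power_series (beta_coef_left b) z.
  rewrite [LHS](eq_power_series _ split_coef) (power_seriesD cC (D := b)) //.
    by rewrite [X in X + _]fz add0r (power_series_shift _ cC').
  by move=> n; case: ifP => // _; rewrite modulus0 ltW.
have : (1 - z ^+ m.+1) * power_series (beta_coef_left b) z = 0.
  by rewrite mulrBl mul1r -E subrr.
move/eqP; rewrite mulf_eq0 subr_eq0 => /orP[/eqP zm|/eqP //].
have : modulus (z ^+ m.+1) < 1 by rewrite modulusX exprn_ilt1 ?modulus_ge0.
by rewrite -zm modulus1 ltxx.
Qed.

Lemma beta_zero_near b z e : 1 < b -> modulus z < 1 -> beta_series b z = 0 ->
  0 < e -> \forall x \near b, 1 < x -> exists w,
    [/\ modulus (w - z) < e, modulus w < 1 & beta_series x w = 0].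
Proof.
move=> b1 z1 fz e0; have b_le : b <= b + 1 by rewrite lerDl.
have [m1 H1] := zero_persists (beta_coef_bounded b1 b_le) (oner_neq0 _) z1 fz e0.
have [m2 H2] := zero_persists (beta_coef_left_bounded b1 b_le) (oner_neq0 _) z1
  (beta_series_left_zero b1 z1 fz) e0.
near=> x => x1.
have xC : coef_bounded (beta_coef x) (b + 1).
  apply: (beta_coef_bounded x1); apply: ltW; near: x.
  by apply: lt_nbhsl; rewrite ltrDl.
have [bx|xb] := leP b x.
  apply: H1 => // -[//|n] nm /=.
  suff -> : digit x 1 n.+1 = digit b 1 n.+1 by [].
  have : forall i, (i < m1)%N -> digit x 1 i.+1 = digit b 1 i.+1.
    by move: bx; near: x; exact: digit_right.
  by apply; exact: ltnW.
apply: H2 => // -[//|n] nm /=.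
suff -> : digit x 1 n.+1 = digit_left b n by [].
have : forall i, (i < m2)%N -> digit x 1 i.+1 = digit_left b i.
  by move: xb; near: x; exact: digit_near_left.
by apply; exact: ltnW.
Unshelve. all: by end_near. Qed.

End beta_series.

(** * Parameters with many zeros are dense *)

Section density.
Variable R : realType.
Implicit Types (b l u x y : R).

(** Between two parameters with different digits the first differing digit
    jumps, and at a jump the orbit of [1] hits [0]; but the digits cannot be
    constant on an interval because orbits separate exponentially. *)
Lemma finite_orbit_dense l u : 1 <= l -> l < u ->
  exists2 b, l < b < u & exists m, orbit b m = 0.
Proof.
move=> l1 lu; apply: contrapT => none.
have nz y m : l < y < u -> orbit y m <> 0.
  by move=> yI y0; apply: none; exists y => //; exists m.
pose b := (2 * l + u) / 3; pose x := (l + 2 * u) / 3.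
have bI : l < b < u by rewrite /b; apply/andP; split; lra.
have xI : l < x < u by rewrite /x; apply/andP; split; lra.
have bx : b < x by rewrite /b /x; lra.
have b1 : 1 < b by case/andP: bI => lb _; exact: le_lt_trans lb.
pose a i := digit b 1 i.+1.
have const m y : l < y < u -> forall i, (i < m)%N -> digit y 1 i.+1 = a i.
  elim: m y => [//|m IHm] y yI i; rewrite ltnS leq_eqVlt => /orP[/eqP->|]; last exact: IHm.
  pose p := 'X * orbit_poly R a m.
  have pE t : l < t < u -> p.[t] = t * orbit t m.
    by move=> tI; rewrite /p !hornerE (orbit_polyE (IHm t tI)).
  have nojump s t : l < s < u -> l < t < u -> ~ Num.floor p.[s] < Num.floor p.[t].
    move=> sI tI jump; pose k := Num.floor p.[t].
    have sk : p.[s] < k%:~R.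
      by rewrite (lt_le_trans (floorD1_gt _))// ler_int lezD1.
    have kt : k%:~R <= p.[t] by exact: floor_le.
    have [||r rst /rootP] := @polyrcf.poly_ivt _ (p - k%:~R%:P) (Num.min s t) (Num.max s t).
    - by rewrite ge_min le_max lexx.
    - rewrite ![(p - _).[_]]hornerD !hornerN !hornerC.
      have sk' : p.[s] - k%:~R <= 0 by rewrite subr_le0 ltW.
      have kt' : 0 <= p.[t] - k%:~R by rewrite subr_ge0.
      by have [st|ts] := leP s t; [exact: mulr_le0_ge0|exact: mulr_ge0_le0].
    have rI : l < r < u.
      have /andP[ls su] := sI; have /andP[lt tu] := tI.
      move: rst; rewrite in_itv/= ge_min le_max => /andP[/orP h1 /orP h2].
      by apply/andP; split; [case: h1|case: h2] => h; lra.
    rewrite hornerD hornerN hornerC => /eqP; rewrite subr_eq0 pE// => /eqP rk.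
    by apply: (nz r m.+1 rI); rewrite orbitS digitE rk intrKfloor subrr.
  rewrite /a !digitE -!pE//; apply/eqP; rewrite eq_le !leNgt.
  by apply/andP; split; apply/negP; exact: nojump.
have xb0 : 0 < x - b by rewrite subr_gt0.
have bi01 : 0 <= b^-1 < 1.
  by rewrite invr_ge0 invf_lt1 ?b1 ?andbT ?(lt_trans ltr01 b1)// ltW// (lt_trans ltr01 b1).
have [n /(_ n (leqnn n))] := exp_small 1 bi01 xb0.
rewrite mul1r exprVn invf_plt ?posrE ?exprn_gt0// ?(lt_trans ltr01 b1)//.
have [_ /(_ isT) H] := @orbit_expand R b x n.+1 b1 (ltW bx) (const n.+1 x xI).
have := orbit_le1 x n.+1; have := orbit_ge0 b n.+1; move: H; rewrite /=.
move=> h1 h2 h3; rewrite -(ltr_pM2r xb0) mulVf ?gt_eqF// ltNge.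
by apply/negP/negPn; lra.
Qed.

(** Moving a parameter with a finite orbit slightly to the right, the orbit
    arrives at a small positive number instead of [0]; it can be given the value
    [x ^- k] for every large [k], and then it takes [k] further steps to [0], with
    digits [0, ..., 0, 1]. *)
Lemma add_digit b m u : 1 < b -> b < u -> orbit b m = 0 ->
  exists M1, forall M, (M1 <= M)%N -> exists x,
    [/\ b < x < u, orbit x M = 0, (m < M)%N &
        forall n, digit x 1 n.+1 = digit b 1 n.+1 + (n.+1 == M)%:Z].
Proof.
move=> b1 bu bm; have b0 : 0 < b := lt_trans ltr01 b1.
have m0 : (0 < m)%N.
  by case: m bm => // /eqP; rewrite /orbit /= oner_eq0.
pose a i := digit b 1 i.+1.
have [y [by_ yu same]] : exists y, [/\ b < y, y < u & forall x, b <= x <= y ->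
    forall i, (i < m)%N -> digit x 1 i.+1 = a i].
  have /nbhs_ballP[e /= e0 He] := digit_right m b1.
  exists (b + Num.min (e / 2) ((u - b) / 2)).
  have h1 : Num.min (e / 2) ((u - b) / 2) <= e / 2 by rewrite ge_min lexx.
  have h2 : Num.min (e / 2) ((u - b) / 2) <= (u - b) / 2 by rewrite ge_min lexx orbT.
  split.
  - by rewrite ltrDl lt_min !divr_gt0// subr_gt0.
  - lra.
  - move=> x /andP[bx xy]; apply: He => //.
    by rewrite /ball/= ler0_norm ?subr_le0//; lra.
pose s := orbit_poly R a m.
have sE x : b <= x <= y -> s.[x] = orbit x m by move=> xI; rewrite (orbit_polyE (same x xI)).
have sb : s.[b] = 0 by rewrite sE ?lexx ?ltW.
have sy : 0 < s.[y].
  rewrite sE ?lexx ?(ltW by_)//.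
  have yI : b <= y <= y by rewrite lexx ltW.
  have [_ /(_ m0)] := @orbit_expand R b y m b1 (ltW by_) (same y yI).
  by rewrite bm subr0; apply: lt_le_trans; rewrite mulr_gt0 ?exprn_gt0// subr_gt0.
have bi01 : 0 <= b^-1 < 1 by rewrite invr_ge0 invf_lt1 ?b1 ?andbT// ltW.
have [k1 Hk1] := exp_small 1 bi01 sy.
exists (m + k1.+1)%N => M; move=> /subnKC <-; move: (M - _)%N => k2.
rewrite -addnA addSn; set k := (k1 + k2)%N.
have skb : 1 < s.[y] * b ^+ k.
  have := Hk1 k (leq_addr _ _).
  by rewrite mul1r exprVn -div1r ltr_pdivrMr ?exprn_gt0.
have [|q qI /rootP] := @polyrcf.poly_ivt _ (s * 'X^(k.+1) - 1) b y (ltW by_).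
  rewrite !hornerE sb mul0r sub0r mulN1r oppr_le0 subr_ge0.
  apply: (le_trans (ltW skb)); rewrite ler_pM2l// exprS.
  rewrite -[leLHS]mul1r ler_pM ?exprn_ge0 ?(ltW b0)//; first by rewrite ltW// (lt_trans b1).
  by rewrite lerXn2r ?nnegrE ?(ltW b0)// ltW// (lt_trans b0).
rewrite in_itv/= in qI; rewrite !hornerE sE// => /eqP; rewrite subr_eq0 => /eqP qm.
have bq : b < q.
  case/andP: qI => bq _; rewrite lt_def bq andbT; apply/eqP => qb.
  by move: qm; rewrite qb bm mul0r => /eqP; rewrite eq_sym oner_eq0.
have q1 : 1 < q := lt_trans b1 bq; have q0 : 0 < q := lt_trans ltr01 q1.
have qorb j : (j <= k)%N -> orbit q (m + j) = q ^- (k - j).+1.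
  elim: j => [_|j IHj jk].
    rewrite addn0 subn0; apply: (mulIf (x := q ^+ k.+1)); first by rewrite expf_neq0 ?gt_eqF.
    by rewrite qm mulVf// expf_neq0 ?gt_eqF.
  rewrite addnS orbitS digitE IHj ?(ltnW jk)// -(subnSK jk) exprS invfM mulrA.
  rewrite divff ?gt_eqF// mul1r.
  rewrite (_ : Num.floor _ = 0) ?subr0//.
  apply: floor_def; rewrite invr_ge0 exprn_ge0 ?(ltW q0)//= invf_lt1 ?exprn_gt0//.
  by rewrite exprn_egt1.
have qlast : orbit q (m + k) = q^-1 by rewrite qorb// subnn expr1.
have dlast : digit q 1 (m + k).+1 = 1.
  by rewrite digitE qlast divff ?gt_eqF// floor1.
have qM : orbit q (m + k.+1) = 0.
  by rewrite addnS orbitS dlast qlast divff ?gt_eqF// subrr.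
exists q; split => //.
- by case/andP: qI => _ qy; rewrite bq (le_lt_trans qy).
- by rewrite addnS ltnS leq_addr.
move=> n; have [nm|mn] := ltnP n m.
  rewrite same ?(ltW bq)//; last by case/andP: qI.
  by rewrite addnS eqSS ltn_eqF ?addr0// (leq_trans nm)// leq_addr.
rewrite (digit_absorbed bm mn) add0r addnS eqSS.
have [->|nM] := eqVneq n (m + k)%N; first by rewrite dlast.
have [nlt|nge] := ltnP n (m + k)%N; last first.
  by rewrite (digit_absorbed qM)// addnS ltn_neqAle eq_sym nM.
have jk : (n - m < k)%N by rewrite ltn_subLR.
rewrite digitE -(subnKC mn) qorb ?(ltnW jk)//.
rewrite exprS invfM mulrA divff ?gt_eqF// mul1r.
apply: floor_def; rewrite invr_ge0 exprn_ge0 ?(ltW q0)//= invf_lt1 ?exprn_gt0//.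
by rewrite exprn_egt1// subn_eq0 -ltnNge.
Qed.

Definition beta_coef_real b n : R :=
  if n is 0%N then 1 else - (digit b 1 n)%:~R.

Definition beta_poly b m : {poly R} := \poly_(n < m.+1) beta_coef_real b n.

Lemma beta_poly_series b m x : 1 < b -> `|x| < 1 -> orbit b m = 0 ->
  beta_series b x%:C = (beta_poly b m).[x]%:C.
Proof.
move=> b1 x1 bm; have xC : modulus x%:C < 1 by rewrite modulus_real.
have coefE n : beta_coef b n = (beta_coef_real b n)%:C.
  by case: n => // n; rewrite /= rmorphN.
apply: (power_series_unique (beta_coef_bounded b1 (lexx b)) xC) => e e0.
exists m.+1 => k; move=> /subnKC <-; elim: (k - _)%N => [|j IHj].
  rewrite addn0 horner_poly rmorph_sum/= /partial_sum.
  rewrite -sumrB big1 ?modulus0// => i _.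
  by rewrite coefE rmorphM rmorphXn subrr.
rewrite addnS partial_sumS /= (digit_absorbed bm) ?leq_addr//.
by rewrite oppr0 mul0r addr0.
Qed.

Lemma beta_poly_add_digit b x m M : (m < M)%N -> orbit b m = 0 ->
  (forall n, digit x 1 n.+1 = digit b 1 n.+1 + (n.+1 == M)%:Z) ->
  beta_poly x M = beta_poly b m - 'X^M.
Proof.
move=> mM bm dx; apply/polyP => -[|n]; rewrite coefB coefXn !coef_poly.
  by rewrite eq_sym gtn_eqF ?subr0// (leq_ltn_trans _ mM).
rewrite !ltnS /= dx; have [nm|mn] := ltnP n m.
  rewrite (leq_trans nm (ltnW mM)) (ltn_eqF (leq_ltn_trans nm mM)).
  by rewrite addr0 subr0.
rewrite (digit_absorbed bm mn) !add0r.
have [->|nM] := eqVneq n.+1 M; first by rewrite leqnn.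
by rewrite oppr0; case: ifP.
Qed.

(** The real zeros on [(-1, 0)] are obtained from sign changes.  Adding a digit
    far away hardly affects the polynomial at given points of [(-1, 0)], while it
    changes its value at [-1] by [1] or [-1].  Repeating this gives the value at
    [-1], and then at a point close to [-1], any desired sign. *)
Definition alternating (p : {poly R}) (y : nat -> R) s :=
  forall i, (i < s)%N -> [/\ -1 < y i < 0, (i.+1 < s)%N -> y i.+1 < y i &
                             0 < (-1) ^+ i * p.[y i]].

Lemma alternating_bump p (y : nat -> R) s : alternating p y s ->
  exists M0, forall M, (M0 <= M)%N -> alternating (p - 'X^M) y s.
Proof.
move=> alt.
suff: \forall M \near \oo, forall i : 'I_s, 0 < (-1) ^+ i * (p - 'X^M).[y i].
  move=> [M0 _ HM]; exists M0 => M /HM H i si; have [h1 h2 _] := alt i si.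
  by split => //; exact: (H (Ordinal si)).
apply: filter_forall => i; have [/andP[y1 y0] _ pos] := alt i (ltn_ord i).
have r01 : 0 <= `|y i| < 1 by rewrite normr_ge0 ltr0_norm//=; lra.
have [M0 HM] := exp_small 1 r01 pos.
exists M0 => // M /= /HM; rewrite mul1r -normrX !hornerE mulrBr.
by rewrite subr_gt0; apply: le_lt_trans; rewrite (le_trans (ler_norm _))// normrMsign.
Qed.

Lemma set_sign_at_N1 s k l u b m (y : nat -> R) : 1 <= l -> l < b < u -> orbit b m = 0 ->
  alternating (beta_poly b m) y s ->
  - k%:R < (-1) ^+ s * (beta_poly b m).[-1] ->
  exists b' m', [/\ l < b' < u, orbit b' m' = 0, alternating (beta_poly b' m') y s &
    0 < (-1) ^+ s * (beta_poly b' m').[-1]].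
Proof.
move=> l1; elim: k b m => [|k IHk] b m bI bm alt sgn.
  by exists b, m; split => //; rewrite oppr0 in sgn.
have /andP[lb bu] := bI.
have [M0 HM0] := alternating_bump alt.
have [M1 HM1] := add_digit (le_lt_trans l1 lb) bu bm.
(* The parity of [M] is that of [s.+1], so that [- (-1) ^+ M = (-1) ^+ s]. *)
pose M := ((maxn M0 M1).*2 + ~~ odd s)%N.
have MM : (maxn M0 M1 <= M)%N by rewrite /M -addnn -addnA leq_addr.
have [x [/andP[bx xu] xM mM dx]] := HM1 M (leq_trans (leq_maxr _ _) MM).
have pE := beta_poly_add_digit mM bm dx.
apply: (IHk x M) => //; first by rewrite (lt_trans lb bx).
  by rewrite pE; apply: HM0; exact: leq_trans (leq_maxl _ _) MM.
rewrite pE !hornerE mulrBr.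
have -> : (-1) ^+ s * (-1) ^+ M = -1 :> R.
  rewrite -exprD -signr_odd oddD /M oddD odd_double /=.
  by case: (odd s); rewrite ?expr1.
by move: sgn; rewrite -natr1; lra.
Qed.

Lemma alternating_dense s l u : 1 <= l -> l < u ->
  exists b m (y : nat -> R), [/\ l < b < u, orbit b m = 0 & alternating (beta_poly b m) y s].
Proof.
move=> l1 lu; elim: s => [|s [b [m [y [bI bm alt]]]]].
  have [b bI [m bm]] := finite_orbit_dense l1 lu.
  by exists b, m, (fun=> 0).
pose v := (-1) ^+ s * (beta_poly b m).[-1].
have [|b' [m' [bI' bm' alt' pos]]] :=
    set_sign_at_N1 (k := (Num.truncn (- v)).+1) l1 bI bm alt.
  by rewrite ltrNl truncnS_gt.
(* The new point is to be placed between [-1] and [t]. *)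
pose t := if s is s'.+1 then y s' else 0.
have t1 : -1 < t.
  have := alt'; rewrite /t; case: (s) => [|s'] alt_s; first by rewrite oppr_lt0.
  by have [/andP[]] := alt_s s' (leqnn _).
have : \forall x \near (-1)^'+, [/\ -1 < x, x < t, x < 0 &
    0 < ((-1) ^+ s *: beta_poly b' m').[x]].
  near=> x; split.
  - by near: x; exact: nbhs_right_gt.
  - by near: x; exact: nbhs_right_lt.
  - by near: x; apply: nbhs_right_lt; rewrite oppr_lt0.
  - near: x.
    apply: (cvgr_gt _ (cvg_at_right_filter (@continuous_horner R _ (-1)))).
    by rewrite hornerZ.
move=> /filter_ex[z [z1 zt z0 zpos]].
exists b', m', (fun i => if (i < s)%N then y i else z); split => // i.
rewrite ltnS leq_eqVlt => /orP[/eqP ->|si].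
  rewrite ltnn z1 z0; split => //; first by rewrite ltnn.
  by move: zpos; rewrite hornerZ.
have [h1 h2 h3] := alt' i si; rewrite si; split => //.
rewrite ltnS leq_eqVlt => /orP[/eqP si'|si']; last by rewrite si'; exact: h2.
by rewrite si' ltnn; move: zt; rewrite /t -si'.
Unshelve. all: by end_near. Qed.

Definition has_zeros b N := exists zs : 'I_N -> R[i], injective zs /\
  forall i, modulus (zs i) < 1 /\ beta_series b (zs i) = 0.

Lemma has_zeros_dense N l u : 1 <= l -> l < u ->
  exists2 b, l < b < u & has_zeros b N.
Proof.
move=> l1 lu; have [b [m [y [bI bm alt]]]] := alternating_dense N.+1 l1 lu.
have b1 : 1 < b by case/andP: bI => lb _; exact: le_lt_trans lb.
have decr i j : (i <= j < N.+1)%N -> y j <= y i.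
  move=> /andP[/subnKC <-]; elim: (j - i)%N => [|k IHk]; first by rewrite addn0.
  rewrite addnS => ik; apply: (@le_trans _ _ (y (i + k)%N)); last exact/IHk/ltnW.
  by have [_ H _] := alt _ (ltnW ik); exact/ltW/H.
have /choice[x xP] (i : 'I_N) : exists x, y i.+1 < x < y i /\ (beta_poly b m).[x] = 0.
  have iN := ltn_ord i; have [_ /(_ iN) lt p1] := alt i (ltnW iN).
  have [_ _ p2] := alt i.+1 iN.
  have [|x] := @polyrcf.poly_ivtoo _ (beta_poly b m) _ _ (ltW lt).
    have := mulr_gt0 p1 p2; rewrite mulrACA -exprD addnS exprS -signr_odd.
    by rewrite oddD addbb expr0 mulr1 mulN1r oppr_gt0 mulrC.
  by rewrite in_itv/= => xI /rootP; exists x.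
have x_unit i : `|x i| < 1.
  have [/andP[x1 x2] _] := xP i; have iN := ltn_ord i.
  have [/andP[_ y0] _ _] := alt i (ltnW iN).
  have [/andP[y1 _] _ _] := alt i.+1 iN.
  by rewrite ltr_norml (lt_trans y1 x1) (lt_trans x2)// (lt_trans y0).
exists b => //; exists (fun i => (x i)%:C); split; last first.
  move=> i; rewrite modulus_real; split => //.
  by rewrite (beta_poly_series b1 (x_unit i) bm) (xP i).2.
have anti (i j : 'I_N) : (i < j)%N -> x j < x i.
  move=> ij; have [/andP[xi _] _] := xP i; have [/andP[_ xj] _] := xP j.
  apply: (lt_trans xj); apply: le_lt_trans xi.
  by apply: decr; rewrite ij ltnS ltnW.
move=> i j /complexI xij; have [ij|ji|/ord_inj//] := ltngtP i j.
  by have := anti _ _ ij; rewrite xij ltxx.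
by have := anti _ _ ji; rewrite xij ltxx.
Qed.

End density.

(** * Open sets of parameters *)

Section topology.
Variable R : realType.
Implicit Types (b x : R) (S : set (betas R)).

Lemma has_zeros_near b N : 1 < b -> has_zeros b N ->
  \forall x \near b, 1 < x -> has_zeros x N.
Proof.
move=> b1 [zs [zs_inj zsP]].
have [e [e0 sep]] : exists e : R, 0 < e /\
    forall i j, i != j -> 2 * e <= modulus (zs i - zs j).
  suff: \forall e \near (0 : R)^'+, 0 < e /\
      forall i j, i != j -> 2 * e <= modulus (zs i - zs j).
    exact: filter_ex.
  near=> e; split; first by near: e; exact: nbhs_right_gt.
  near: e; apply: filter_forall => i; apply: filter_forall => j.
  have [->|ij] := eqVneq i j; first by near=> e; rewrite ?eqxx.
  near=> e => _; rewrite mulrC -ler_pdivlMr// ltW//; near: e.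
  apply: nbhs_right_lt; rewrite divr_gt0// modulus_gt0 subr_eq0.
  by apply: contra ij => /eqP/zs_inj ->.
have near_zero i := beta_zero_near b1 (zsP i).1 (zsP i).2 e0.
have := filter_forall (nbhs_filter b) near_zero.
apply: filterS => x H x1; have /choice[w wP] := fun i => H i x1.
exists w; split=> [i j wij|i]; last by have [] := wP i.
apply/eqP/negP => /negP /sep; apply/negP; rewrite -ltNge.
apply: (le_lt_trans (modulus_triangle (w i) _ _)).
rewrite mulr_natl mulr2n; apply: ltrD; first by rewrite modulusB; have [] := wP i.
by rewrite wij; have [] := wP j.
Unshelve. all: by end_near. Qed.

Lemma open_betas (P : R -> Prop) :
  (forall b, 1 < b -> P b -> \forall x \near b, 1 < x -> P x) ->
  open [set b : betas R | P (\val b)].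
Proof.
move=> nearP; rewrite openE => b Pb.
have H : nbhs b (set_val @^-1` [set x | 1 < x -> P x]) :=
  @initial_continuous (betas R) R set_val b _ (nearP _ (betas_gt1 b) Pb).
by apply: filterS H => x /= H; exact/H/betas_gt1.
Qed.

Lemma dense_betas (P : R -> Prop) :
  (forall l u, 1 <= l -> l < u -> exists2 b, l < b < u & P b) ->
  dense [set b : betas R | P (\val b)].
Proof.
move=> dP O [b0 Ob0] [W openW WO].
have b01 := betas_gt1 b0.
have Wb0 : W (\val b0) by move: Ob0; rewrite -WO.
have := openW; rewrite openE => /(_ _ Wb0); rewrite /interior.
move=> /nbhs_ballP[e /= e0 We].
have [|b /andP[b0b be] Pb] := dP (\val b0) (\val b0 + e) (ltW b01).
  by rewrite ltrDl.
have bB : b \in betas R.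
  by apply/mem_set; rewrite /betas/= in_itv/= andbT (lt_trans b01).
exists (SigSub bB); split => //; rewrite -WO; apply: We.
by rewrite /ball/= distrC ger0_norm ?subr_ge0 ?(ltW b0b)// ltrBlDl.
Qed.

End topology.

(** * Eigenfunctions from zeros *)

Section eigenfunction.
Variable R : realType.
Implicit Types (b u v x : R) (z : R[i]).

Definition step b v n : R[i] := (v < orbit b n)%R%:R.

(** If [z = 1 / (b * lam)] is a zero of [beta_series b] then this is the
    eigenfunction for [lam]: the operator maps the indicator of [[0, t[] to that
    of [[0, beta_map b t[], up to constants. *)
Definition eigenfun b z v := power_series (step b v) z.

Lemma step_bounded b v : coef_bounded (step b v) 1.
Proof. by move=> n; rewrite /step; case: ltP => _; rewrite ?modulus1// modulus0. Qed.

Lemma eigenfun_ge1 b z v : modulus z < 1 -> 1 <= v -> eigenfun b z v = 0.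
Proof.
move=> z1 v1; apply: (power_series_unique (step_bounded b v) z1) => e e0.
exists 0%N => m _; rewrite /partial_sum big1 ?subrr ?modulus0// => i _.
by rewrite /step ltNge (le_trans (orbit_le1 _ _) v1) mul0r.
Qed.

Lemma power_series_majorant (c : nat -> R[i]) (d : nat -> R) C z :
  modulus z < 1 -> (forall n, modulus (c n) <= d n) -> (forall n, d n <= C) ->
  modulus (power_series c z) <=
    complex.Re (power_series (fun n => (d n)%:C) (modulus z)%:C).
Proof.
move=> z1 cd dC.
have cC : coef_bounded c C by move=> n; exact: le_trans (cd n) (dC n).
have dC' : coef_bounded (fun n => (d n)%:C) C.
  by move=> n; rewrite modulus_real ger0_norm// (le_trans (modulus_ge0 _) (cd n)).
have zz : modulus (modulus z)%:C < 1 by rewrite modulus_real ger0_norm ?modulus_ge0.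
apply/ler_addgt0Pr => e e0; have e2 : 0 < e / 2 by rewrite divr_gt0.
have [m1 H1] := power_series_limit cC z1 e2.
have [m2 H2] := power_series_limit dC' zz e2.
have {}H1 := H1 (maxn m1 m2) (leq_maxl _ _).
have {}H2 := H2 (maxn m1 m2) (leq_maxr _ _); move: (maxn m1 m2) => m in H1 H2 *.
have H3 : modulus (partial_sum c z m) <=
    complex.Re (partial_sum (fun n => (d n)%:C) (modulus z)%:C m).
  rewrite /partial_sum Re_sum (le_trans (modulus_sum _ _ _))//.
  apply: ler_sum => i _; rewrite modulusM modulusX -rmorphXn -rmorphM/=.
  by rewrite ler_wpM2r ?exprn_ge0 ?modulus_ge0.
have ReB (a a' : R[i]) : complex.Re (a - a') = complex.Re a - complex.Re a'.
  by case: a a' => ? ? [].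
apply: (le_trans (modulus_dist _ (partial_sum c z m))).
rewrite [e]splitr addrA lerD ?(ltW H1)//.
apply: (le_trans H3); rewrite -lerBlDl; apply: (le_trans (ler_norm _)).
by rewrite distrC -ReB; apply: (le_trans (Re_le_modulus _)); exact: ltW H2.
Qed.

(** The indicators decrease in [v], hence the real decreasing function
    [eigenfun b `|z|] dominates the increments. *)
Lemma eigenfun_variation b z (t : nat -> R) n : modulus z < 1 ->
  {homo t : i j / (i <= j)%N >-> i <= j} ->
  \sum_(i < n) modulus (eigenfun b z (t i.+1) - eigenfun b z (t i)) <=
    2 / (1 - modulus z).
Proof.
move=> z1 t_mono.
have zz : modulus (modulus z)%:C = modulus z by rewrite modulus_real ger0_norm ?modulus_ge0.
have zz1 : modulus (modulus z)%:C < 1 by rewrite zz.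
pose g v := complex.Re (eigenfun b (modulus z)%:C v).
have diff (x : R[i]) u v : modulus x < 1 -> eigenfun b x v - eigenfun b x u =
    power_series (fun k => step b v k + (-1) * step b u k) x.
  move=> x1; rewrite (power_seriesD (step_bounded b v) (D := 1))//.
    by rewrite (power_seriesZ _ (step_bounded b u))// mulN1r.
  by move=> k; rewrite modulusM modulusN modulus1 mul1r; exact: step_bounded.
have incr u v : u <= v -> modulus (eigenfun b z v - eigenfun b z u) <= g u - g v.
  move=> uv; rewrite modulusB diff//.
  have dE k : (step b u k + (-1) * step b v k) =
      ((u < orbit b k)%R%:R - (v < orbit b k)%R%:R)%:C.
    by rewrite rmorphB !rmorph_nat mulN1r.
  have ReB (a a' : R[i]) : complex.Re (a - a') = complex.Re a - complex.Re a'.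
    by case: a a' => ? ? [].
  rewrite /g -ReB diff// [X in _ <= complex.Re X](eq_power_series _ dE).
  apply: (@power_series_majorant _
    (fun k => (u < orbit b k)%R%:R - (v < orbit b k)%R%:R) 1) => // k; last first.
    by case: ltP => _; case: ltP => _; rewrite ?subrr ?subr0 ?sub0r ?ler01 ?oppr_le0.
  rewrite dE modulus_real ger0_norm// subr_ge0 ler_nat.
  have [vk|//] := ltP v; by rewrite (le_lt_trans uv vk).
have g_bound v : `|g v| <= 1 / (1 - modulus z).
  apply: (le_trans (Re_le_modulus _)); rewrite -[X in 1 / (1 - X)]zz.
  exact: power_series_bound (step_bounded b v) zz1.
apply: (@le_trans _ _ (\sum_(i < n) (g (t i) - g (t i.+1)))).
  by apply: ler_sum => i _; apply: incr; exact: t_mono.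
rewrite -(big_mkord xpredT (fun i => g (t i) - g (t i.+1))).
have -> : \sum_(0 <= i < n) (g (t i) - g (t i.+1)) = g (t 0%N) - g (t n).
  elim: n => [|n IHn]; first by rewrite big_geq// subrr.
  by rewrite big_nat_recr//= IHn addrA subrK.
have := g_bound (t 0%N); have := g_bound (t n); rewrite !ler_norml.
rewrite mulrDl mul1r => /andP[h1 h2] /andP[h3 h4]; lra.
Qed.

Lemma eigenfun_near1 b z e : modulus z < 1 -> 0 < e ->
  \forall v \near 1^'-, modulus (eigenfun b z v - 1) < e.
Proof.
move=> z1 e0; have z01 : 0 <= modulus z < 1 by rewrite modulus_ge0.
have [M HM] := @exp_small _ (1 / (1 - modulus z)) e _ z01 e0.
have far i : \forall v \near (1 : R)^'-, orbit b i.+1 < v.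
  by apply: nbhs_left_gt; exact: orbitS_lt1.
have farM : \forall v \near (1 : R)^'-, forall i : 'I_M, orbit b i.+1 < v.
  exact: filter_forall (fun i : 'I_M => far i).
near=> v; have v1 : v < 1 by near: v; exact: nbhs_left_lt.
have vM : forall i : 'I_M, orbit b i.+1 < v by near: v.
have -> : 1 = partial_sum (step b v) z M.+1.
  rewrite partial_sum_recl {1}/step /= v1 /partial_sum big1 ?mulr0 ?addr0// => i _.
  by rewrite /step ltNge ltW ?vM// mul0r.
apply: le_lt_trans (power_series_error M.+1 (step_bounded b v) (lexx _) z1) _.
by rewrite mulrAC HM.
Unshelve. all: by end_near. Qed.

Lemma count_preimages b x n : 1 < b -> 0 <= x < 1 ->
  \sum_(k < nbranch b) step b ((x + k%:R) / b) n =
    (digit b 1 n.+1)%:~R + step b x n.+1.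
Proof.
move=> b1 /andP[x0 x1]; have b0 : 0 < b := lt_trans ltr01 b1.
pose d := `|digit b 1 n.+1|%N.
have dE : digit b 1 n.+1 = d%:Z by rewrite gez0_abs ?digit_ge0 ?ltW.
have bT : b * orbit b n = d%:R + orbit b n.+1.
  by rewrite orbitS dE addrC subrK.
have dK : (d < nbranch b)%N.
  rewrite /nbranch ltnS -lez_nat -dE gez0_abs ?floor_ge0 ?(ltW b0)// digitE.
  by apply: le_floor; rewrite ler_piMr ?orbit_le1// ltW.
have stepE k : step b ((x + k%:R) / b) n = (x + k%:R < d%:R + orbit b n.+1)%R%:R.
  by rewrite /step ltr_pdivrMr// [orbit b n * b]mulrC bT.
under eq_bigr do rewrite stepE.
rewrite -(big_mkord xpredT (fun k => (x + k%:R < d%:R + orbit b n.+1)%R%:R)).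
rewrite (@big_cat_nat _ _ _ d)//=; last exact: ltnW.
rewrite big_nat (eq_bigr (fun=> 1)) => [|k /andP[_ kd]]; last first.
  have -> // : x + k%:R < d%:R + orbit b n.+1.
  apply: (@lt_le_trans _ _ (1 + k%:R)); first by rewrite ltrD2r.
  by rewrite ler_wpDr ?orbitS_ge0// addrC natr1 ler_nat.
rewrite -big_nat big_const_nat subn0 iter_addr_0 dE; congr (_ + _).
rewrite big_ltn// big_nat big1 ?addr0; first by rewrite /step addrC ltrD2l.
move=> k /andP[dk _]; rewrite ltNge (_ : _ <= _)//.
apply: (@le_trans _ _ (d%:R + 1)); first by rewrite lerD2l ltW ?orbitS_lt1.
by rewrite natr1 ler_wpDl// ler_nat.
Qed.

Lemma power_series_sum (I : Type) (s : seq I) (c : I -> nat -> R[i]) C z :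
  (forall i, coef_bounded (c i) C) -> modulus z < 1 ->
  power_series (fun n => \sum_(i <- s) c i n) z = \sum_(i <- s) power_series (c i) z.
Proof.
move=> cC z1; elim: s => [|i s IHs].
  rewrite big_nil; apply: (@power_series_unique _ _ 0) => //.
    by move=> n; rewrite big_nil modulus0.
  move=> e e0; exists 0%N => m _; rewrite /partial_sum big1 ?subrr ?modulus0// => k _.
  by rewrite big_nil mul0r.
rewrite big_cons -IHs; under eq_power_series do rewrite big_cons.
apply: (power_seriesD (cC i) (D := C *+ size s)) => // n.
rewrite (le_trans (modulus_sum _ _ _))//.
rewrite (le_trans (ler_sum _ (fun j _ => cC j n)))//.
by rewrite big_const_seq count_predT iter_addr_0.
Qed.

Lemma eigenfun_transfer b z x : 1 < b -> modulus z < 1 -> 0 <= x < 1 ->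
  z * \sum_(k < nbranch b) eigenfun b z ((x + k%:R) / b) =
    eigenfun b z x - beta_series b z.
Proof.
move=> b1 z1 xI; have b0 := lt_trans ltr01 b1.
have dC : coef_bounded (fun n => beta_coef b n.+1) b.
  by move=> n; exact: beta_coef_bounded.
rewrite -(power_series_sum _ (fun k : 'I__ => step_bounded b ((x + k%:R) / b)) z1).
have E n : \sum_(k < nbranch b) step b ((x + k%:R) / b) n =
    step b x n.+1 + (-1) * beta_coef b n.+1.
  by rewrite count_preimages// mulN1r opprK addrC rmorph_int.
rewrite (eq_power_series _ E) (@power_seriesD _ _ _ 1 b)//; last 2 first.
  by move=> n; exact: step_bounded.
  by move=> n; rewrite mulN1r modulusN.
rewrite (power_seriesZ _ dC)// mulN1r mulrBr.
rewrite /eigenfun (power_series_recl (step_bounded b x))//.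
rewrite /beta_series (power_series_recl (beta_coef_bounded b1 (lexx b)))//.
have -> : step b x 0 = 1 by rewrite /step; case/andP: xI => _ ->.
by rewrite opprD addrACA subrr add0r.
Qed.

End eigenfunction.

(** * Contraction of the variation *)

Section contraction.
Variable R : realType.
Variables (g : R -> R[i]) (good : R -> Prop) (b : R) (z kappa : R[i]) (K : nat).
Variable (S0 : R).
Hypothesis b_gt1 : 1 < b.
Hypothesis z_lt1 : modulus z < 1.
Hypothesis good_itv : forall x, good x -> 0 <= x < 1.
Hypothesis good_preimage : forall x k, good x ->
  good ((x + k%:R) / b) \/ 1 <= (x + k%:R) / b.
Hypothesis g_ge1 : forall v, 1 <= v -> g v = 0.
Hypothesis g_eq : forall x, good x ->
  g x = z * (\sum_(k < K) g ((x + k%:R) / b)) + kappa.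
Hypothesis g_bv : forall (t : nat -> R) n,
  {homo t : i j / (i <= j)%N >-> i <= j} -> (forall i, good (t i)) ->
  \sum_(i < n) modulus (g (t i.+1) - g (t i)) <= S0.
Hypothesis g_near1 : forall e y, 0 < e -> y < 1 ->
  exists2 v, good v & y < v /\ modulus (g v) < e.

Let variations v : set R := [set s | exists (t : nat -> R) n,
  [/\ {homo t : i j / (i <= j)%N >-> i <= j}, forall i, good (t i),
      forall i, t i <= v & s = \sum_(i < n) modulus (g (t i.+1) - g (t i))]].

(** As in the Jordan decomposition, [W] is nondecreasing and its increments
    dominate those of [g]; since [g] tends to [0] at [1] along good points, this
    remains true across [1] ([W_dist]). *)
Let W v : R := sup (variations v).

Let ok v := good v \/ 1 <= v.

Let variations_ub v : ubound (variations v) S0.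
Proof. by move=> _ [t [n [h1 h2 _ ->]]]; exact: g_bv. Qed.

Let ok_sup v : ok v -> has_sup (variations v).
Proof.
move=> okv; split; last by exists S0; exact: variations_ub.
have [x gx xv] : exists2 x, good x & x <= v.
  case: okv => [gv|v1]; first by exists v.
  have [x gx _] := g_near1 ltr01 (ltr01 : 0 < 1 :> R).
  exists x => //; have /andP[_ x1] := good_itv gx.
  by rewrite (le_trans (ltW x1)).
by exists 0, (fun=> x), 0%N; split => //; rewrite big_ord0.
Qed.

Let W_ge0 v : ok v -> 0 <= W v.
Proof.
move=> okv; have [[s [t [n [h1 h2 h3 h4]]]] _] := ok_sup okv.
apply: sup_upper_bound; first exact: ok_sup.
by exists t, 0%N; split => //; rewrite big_ord0.
Qed.

Let W_mono u v : ok u -> u <= v -> W u <= W v.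
Proof.
move=> oku uv; apply: ge_sup; first by case: (ok_sup oku).
move=> s [t [n [h1 h2 h3 h4]]].
have ts : variations v s.
  by exists t, n; split => // i; exact: le_trans (h3 i) uv.
by apply: sup_upper_bound => //; split; [exists s|exists S0; exact: variations_ub].
Qed.

Let W_incr x y : good x -> good y -> x <= y -> W x + modulus (g y - g x) <= W y.
Proof.
move=> gx gy xy; rewrite -lerBrDr; apply: ge_sup.
  by case: (ok_sup (or_introl gx)).
move=> _ [t [n [h1 h2 h3 ->]]]; rewrite lerBrDr.
pose t' i := if (i <= n)%N then t i else if i == n.+1 then x else y.
have t'_le i : (i <= n)%N -> t' i = t i by rewrite /t' => ->.
have t'_n1 : t' n.+1 = x by rewrite /t' ltnn eqxx.
have t'_n2 : t' n.+2 = y by rewrite /t' ltnNge leqnSn /= gtn_eqF.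
apply: (@le_trans _ _ (\sum_(i < n.+2) modulus (g (t' i.+1) - g (t' i)))).
  rewrite !big_ord_recr/= t'_n2 t'_n1 lerD2r.
  rewrite -[leLHS]addr0 lerD ?modulus_ge0// le_eqVlt; apply/orP; left; apply/eqP.
  by apply: eq_bigr => i _; rewrite !t'_le// ltnW.
apply: sup_upper_bound; first by apply: ok_sup; left.
have good_t' i : good (t' i) by rewrite /t'; case: ifP => // _; case: ifP.
have t'_y i : t' i <= y.
  rewrite /t'; case: ifP => // _; first by rewrite (le_trans (h3 i)).
  by case: ifP.
exists t', n.+2; split => // i j ij.
have [ni|ni] := leqP i n.
  rewrite t'_le// /t'; case: ifP => [_|_]; first exact: h1.
  by case: ifP => // _; rewrite (le_trans (h3 i)).
have [i1|i1] := eqVneq i n.+1.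
  by rewrite i1 t'_n1 /t' leqNgt (leq_trans ni ij) /=; case: ifP.
have nj : (n.+1 < j)%N by rewrite (leq_trans _ ij)// ltn_neqAle eq_sym i1.
by rewrite {2}/t' leqNgt ltnW//= gtn_eqF// t'_y.
Qed.

Let W_ge1 v : 1 <= v -> W v = W 1.
Proof.
move=> v1; rewrite /W; congr sup; apply/seteqP.
split=> s [t [n [h1 h2 h3 h4]]]; exists t, n; split => // i.
  by have /andP[_ /ltW] := good_itv (h2 i).
exact: le_trans (h3 i) v1.
Qed.

Let W_end y : good y -> W y + modulus (g y) <= W 1.
Proof.
move=> gy; have /andP[_ y1] := good_itv gy; apply/ler_addgt0Pr => e e0.
have [v gv [yv ve]] := g_near1 e0 y1; have /andP[_ v1] := good_itv gv.
have h1 := W_incr gy gv (ltW yv).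
have h2 := W_mono (or_introl gv) (ltW v1).
have := modulus_dist (g y) (g v); rewrite [modulus (g y - g v)]modulusB.
lra.
Qed.

Let W_dist u v : ok u -> ok v -> u <= v -> modulus (g v - g u) <= W v - W u.
Proof.
move=> oku okv uv; case: (oku) (okv) => [gu|u1] [gv|v1].
- by rewrite lerBrDl W_incr.
- by rewrite (W_ge1 v1) (g_ge1 v1) sub0r modulusN lerBrDl W_end.
- have /andP[_] := good_itv gv.
  by rewrite ltNge (le_trans u1 uv).
- by rewrite (g_ge1 u1) (g_ge1 v1) subrr modulus0 subr_ge0 W_mono.
Qed.

(** The branches of the map are disjoint, so that the variations of [g] along
    the preimages of a subdivision add up to at most [W 1]. *)
Let sum_branches (t : nat -> R) n :
  {homo t : i j / (i <= j)%N >-> i <= j} -> (forall i, good (t i)) ->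
  \sum_(i < n) \sum_(k < K)
    modulus (g ((t i.+1 + k%:R) / b) - g ((t i + k%:R) / b)) <= W 1.
Proof.
move=> tm tg; have b0 : 0 < b := lt_trans ltr01 b_gt1.
pose y k i := (t i + k%:R) / b.
have y_ok k i : ok (y k i) by exact: good_preimage.
have yW k i j : (i <= j)%N -> y k i <= y k j.
  by move=> ij; rewrite ler_pM2r ?invr_gt0// lerD2r tm.
rewrite exchange_big/=.
apply: (@le_trans _ _ (\sum_(k < K) (W (y k.+1 0%N) - W (y k 0%N)))).
  apply: ler_sum => k _.
  apply: (@le_trans _ _ (W (y k n) - W (y k 0%N))).
    apply: (@le_trans _ _ (\sum_(i < n) (W (y k i.+1) - W (y k i)))).
      apply: ler_sum => i _.
      exact: W_dist (y_ok k i) (y_ok k i.+1) (yW k _ _ (leqnSn i)).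
    rewrite -(big_mkord xpredT (fun i => W (y k i.+1) - W (y k i))).
    by rewrite telescope_sumr.
  rewrite lerD2r; apply: W_mono => //.
  rewrite ler_pM2r ?invr_gt0// -natr1 addrA addrAC lerD2r.
  have /andP[_ /ltW tn] := good_itv (tg n); have /andP[t0 _] := good_itv (tg 0%N).
  by rewrite (le_trans tn)// lerDr.
rewrite -(big_mkord xpredT (fun k => W (y k.+1 0%N) - W (y k 0%N))).
rewrite telescope_sumr// lerBlDr -[leLHS]addr0 lerD ?W_ge0//.
have [y1|y1] := leP 1 (y K 0%N); first by rewrite (W_ge1 y1).
by apply: W_mono; rewrite ?(ltW y1).
Qed.

Lemma contraction_eq0 x : good x -> g x = 0.
Proof.
move=> gx; have ok1 : ok 1 by right.
have r0 := modulus_ge0 z.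
have WW : W 1 <= modulus z * W 1.
  apply: ge_sup; first by case: (ok_sup ok1).
  move=> _ [t [n [tm tg _ ->]]].
  apply: (le_trans _ (ler_wpM2l r0 (sum_branches n tm tg))).
  rewrite mulr_sumr; apply: ler_sum => i _.
  rewrite !g_eq// opprD addrACA subrr addr0 -mulrBr modulusM.
  by rewrite ler_wpM2l// -sumrB modulus_sum.
have W10 : W 1 <= 0.
  rewrite leNgt; apply/negP => W0; move: WW.
  by rewrite leNgt gtr_pMl// z_lt1.
apply/eqP; rewrite -modulus_eq0 eq_le modulus_ge0 andbT.
have := W_end gx; have := W_ge0 (or_introl gx); lra.
Qed.

End contraction.

(** * Eigenvalues are inverses of zeros *)

Section spectrum.
Variable R : realType.
Local Notation I := (unit_itv R).
Implicit Types (b v : R) (z : R[i]) (x y : I) (f : I -> R[i]) (A : set I).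

Lemma avoid_countable (B : set R) (a c : R) : countable B -> a < c ->
  exists2 v, a < v < c & ~ B v.
Proof.
move=> cB ac; apply: contrapT => none.
have sub : `]a, c[%classic `<=` B.
  move=> v /=; rewrite in_itv/= => vI; apply: contrapT => nB.
  by apply: none; exists v.
have := countable_lebesgue_measure0 (sub_countable (subset_card_le sub) cB).
rewrite lebesgue_measure_itv/= lte_fin ac -EFinD => /eqP.
by rewrite eqe subr_eq0 gt_eqF.
Qed.

Lemma is_bounded_variation_modulus f : is_bounded_variation f ->
  exists M, forall (t : nat -> I) n,
    {homo t : i j / (i <= j)%N >-> \val i <= \val j} ->
    \sum_(i < n) modulus (f (t i.+1) - f (t i)) <= M.
Proof.
move=> [M HM]; exists M => t n tm; rewrite -lecR rmorph_sum.
by apply: le_trans (HM t n tm); apply: ler_sum => i _; rewrite normE.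
Qed.

Lemma modulus_is_bounded_variation f M :
  (forall (t : nat -> I) n, {homo t : i j / (i <= j)%N >-> \val i <= \val j} ->
    \sum_(i < n) modulus (f (t i.+1) - f (t i)) <= M) ->
  is_bounded_variation f.
Proof.
move=> H; exists M => t n tm; have := H t n tm; rewrite -lecR rmorph_sum.
by apply: le_trans; apply: ler_sum => i _; rewrite normE.
Qed.

(** Extending by zero turns the sum over those branches that reach a point into
    a sum over all of them. *)
Definition ext0 f v : R[i] :=
  if pselect (0 <= v <= 1) is left h then
    if v < 1 then f (mk_unit h) else 0 else 0.

Lemma ext0_val f x : \val x < 1 -> ext0 f (\val x) = f x.
Proof.
move=> x1; rewrite /ext0; case: pselect => [h|/(_ (unit_itvP x))//].
by rewrite x1; congr f; exact/val_inj.
Qed.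

Lemma ext0_ge1 f v : 1 <= v -> ext0 f v = 0.
Proof. by move=> v1; rewrite /ext0; case: pselect => // h; rewrite ltNge v1. Qed.

Lemma transfer_ext0 b f x : 1 < b -> \val x < 1 -> \val x <> orbit b 1 ->
  transfer b f x = (b^-1)%:C *
    \sum_(k < nbranch b) ext0 f ((\val x + k%:R) / b).
Proof.
move=> b1 x1 xT; have b0 : 0 < b := lt_trans ltr01 b1.
have /andP[x0 _] := unit_itvP x.
rewrite transferE//; congr (_ * _); apply: eq_bigr => k _.
case: ifPn => [kx|]; last first.
  rewrite /branch_dom x1/= -ltNge => bk; rewrite ext0_ge1//.
  by rewrite ler_pdivlMr// mul1r ltW.
have vE : \val (branch b1 k x) = (\val x + k%:R) / b.
  by rewrite -(branch_val b1 kx) mulrC mulKf// gt_eqF.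
rewrite -vE ext0_val// lt_def; have /andP[_ ->] := unit_itvP (branch b1 k x).
rewrite andbT eq_sym; apply/eqP => v1; apply: xT.
have bE : b = \val x + k%:R by rewrite -(branch_val b1 kx) v1 mulr1.
rewrite orbitS digitE mulr1 {1}bE.
rewrite (_ : Num.floor b = k%:Z) ?addrK//.
apply: floor_def; rewrite -pmulrn intrD -pmulrn.
apply/andP; split; first by rewrite [leRHS]bE lerDr.
by rewrite [ltLHS]bE addrC ltrD2l.
Qed.

Lemma transfer_eigenfun b z x : 1 < b -> modulus z < 1 -> \val x < 1 ->
  z * transfer b (fun y => eigenfun b z (\val y)) x =
  (b^-1)%:C * (eigenfun b z (\val x) - beta_series b z).
Proof.
move=> b1 z1 x1; have b0 : 0 < b := lt_trans ltr01 b1.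
have /andP[x0 _] := unit_itvP x.
rewrite transferE// mulrCA -eigenfun_transfer ?x0//; congr (_ * (_ * _)).
apply: eq_bigr => k _; case: ifPn => [kx|].
  by rewrite -(branch_val b1 kx) mulrAC divff ?mul1r// gt_eqF.
rewrite /branch_dom x1/= -ltNge => bk; rewrite eigenfun_ge1//.
by rewrite ler_pdivlMr// mul1r ltW.
Qed.

Lemma eigenfun_bv b z : modulus z < 1 ->
  (fun y : I => eigenfun b z (\val y)) \in @bv_pred R.
Proof.
move=> z1; apply/bv_predP.
apply: (modulus_is_bounded_variation (M := 2 / (1 - modulus z))) => t n tm.
exact: (@eigenfun_variation _ b z (fun i => \val (t i)) n z1 tm).
Qed.

Lemma countable_val A : countable A -> countable ((fun x : I => \val x) @` A).
Proof. by move=> cA; exact: sub_countable (card_image_le _ _) cA. Qed.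

Theorem zero_is_eigenvalue (b : betas R) z : modulus z < 1 -> z != 0 ->
  beta_series (\val b) z = 0 ->
  is_eigenvalue (transfer_BVhat b) ((\val b)%:C * z)^-1.
Proof.
move=> z1 z0 fz; have b1 := betas_gt1 b.
have b0 : 0 < \val b := lt_trans ltr01 b1.
apply/eigenvalue_BVhatP.
exists (MkBV (eigenfun_bv (\val b) z1)).
  apply/asboolP => -[A [cA Av]].
  have near1 := eigenfun_near1 (\val b) z1 (ltr01 : 0 < 1 :> R).
  have [a a1 Ha] : exists2 a : R, a < 1 & forall v, a < v < 1 ->
      modulus (eigenfun (\val b) z v - 1) < 1.
    have [e /= e0 He] := near1.
    exists (1 - e); rewrite ?gtrBl// => v /andP[v1 v2]; apply: He => //.
    by rewrite /ball_/= ger0_norm; lra.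
  have a01 : Num.max a 0 < 1 by rewrite gt_max a1 ltr01.
  have [v /andP[av v1] nA] := avoid_countable (countable_val cA) a01.
  move: av; rewrite gt_max => /andP[av v0].
  have vI : 0 <= v <= 1 by rewrite !ltW.
  have : eigenfun (\val b) z v = 0.
    by apply: (Av (mk_unit vI)) => Ax; apply: nA; exists (mk_unit vI).
  move=> ev; have := Ha v; rewrite av v1 ev sub0r modulusN modulus1 ltxx.
  by move=> /(_ isT).
apply/asboolP; exists [set mk_unit (v := 1) (introT andP (conj ler01 (lexx _)))].
split; first exact: countable1.
move=> x xn1; have x1 : \val x < 1.
  have /andP[_ x1] := unit_itvP x; rewrite lt_def x1 andbT eq_sym.
  by apply/eqP => xE; apply: xn1; exact/val_inj.
apply: (mulfI z0).
rewrite mulr0 -[X in z * X]/(transfer (\val b) (fun y => eigenfun (\val b) z (\val y)) x -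
  ((\val b)%:C * z)^-1 * eigenfun (\val b) z (\val x)).
have B0 : (\val b)%:C != 0 :> R[i] by rewrite fmorph_eq0 gt_eqF.
rewrite mulrBr transfer_eigenfun// fz subr0 fmorphV.
by field; rewrite z0.
Qed.

(** Let [h] be an eigenfunction and [c] a limit point of [h] at [1].  In the
    difference of [h] and [c] times the function [eigenfun] the jump at [1], which
    is what feeds the discontinuities along the orbit of [1], has been removed.  Its
    variation is therefore contracted by [|z| < 1] and the difference vanishes; the
    constant by which [eigenfun] fails to be an eigenfunction then vanishes too.
    All this takes place outside a countable set [bad], invariant under the map
    and containing the exceptional set and [1]. *)
Theorem eigenvalue_is_zero (b : betas R) (lam : R[i]) :
  is_eigenvalue (transfer_BVhat b) lam -> (\val b)^-1 < modulus lam ->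
  beta_series (\val b) ((\val b)%:C * lam)^-1 = 0.
Proof.
move=> /eigenvalue_BVhatP[f f_nonnull /asboolP[A [cA fA]]] lamb.
have b1 := betas_gt1 b; set beta := \val b in b1 lamb *.
have beta0 : 0 < beta := lt_trans ltr01 b1.
have lam0 : lam != 0 by rewrite -modulus_gt0 (lt_trans _ lamb)// invr_gt0.
set z := (beta%:C * lam)^-1.
have z1 : modulus z < 1.
  rewrite modulusV modulusM modulus_real gtr0_norm// invf_lt1.
    by rewrite mulrC -ltr_pdivrMr// div1r.
  by rewrite mulr_gt0 ?modulus_gt0.
have map01 (y : I) : 0 <= beta_map beta (\val y) <= 1.
  by rewrite /beta_map subr_ge0 floor_le lerBlDr addrC -intrD1 ltW ?floorD1_gt.
(* [bad] also contains the orbit of [1], which excludes the points one of whose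
   preimages is [1]. *)
pose tau y : I := mk_unit (map01 y).
pose one : I := mk_unit (v := 1) (introT andP (conj ler01 (lexx _))).
pose bad : set I := \bigcup_n (iter n tau @` (A `|` [set one])).
have bad_countable : countable bad.
  apply: bigcup_countable => // n _.
  apply: sub_countable (card_image_le _ _) _.
  rewrite -bigcup2E; apply: bigcup_countable => // -[|[|k]] _ //=.
have bad_A x : A x -> bad x by move=> Ax; exists 0%N => //; exists x => //; left.
have bad_one : bad one by exists 0%N => //; exists one => //; right.
have bad_tau x : bad x -> bad (tau x).
  by move=> [n _ [y Ay <-]]; exists n.+1 => //; exists y => //.
pose good v := exists x : I, [/\ \val x = v, v < 1 & ~ bad x].
have good_itv v : good v -> 0 <= v < 1.
  by move=> [x [<- -> _]]; rewrite andbT; case/andP: (unit_itvP x).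
have good_preimage v k : good v -> good ((v + k%:R) / beta) \/ 1 <= (v + k%:R) / beta.
  move=> gv; have /andP[v0 v1] := good_itv v gv; have [x [xv _ nbx]] := gv.
  have [?|yl1] := leP 1 ((v + k%:R) / beta); first by right.
  have yI : 0 <= (v + k%:R) / beta <= 1.
    by rewrite (ltW yl1) divr_ge0 ?addr_ge0// ltW.
  left; exists (mk_unit yI); split => // /bad_tau; apply: contra_not nbx.
  congr bad; apply/val_inj => /=; rewrite xv /beta_map mulrC divfK ?gt_eqF//.
  rewrite (_ : Num.floor _ = k%:Z) ?addrK//.
  by apply: floor_def; rewrite -pmulrn intrD -pmulrn lerDr v0/= addrC ltrD2l.
have good_near a : a < 1 -> exists2 v, good v & a < v.
  move=> a1; have a01 : Num.max a 0 < 1 by rewrite gt_max a1 ltr01.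
  have [v /andP[av v1] nbad] := avoid_countable (countable_val bad_countable) a01.
  move: av; rewrite gt_max => /andP[av v0].
  have vI : 0 <= v <= 1 by rewrite !ltW.
  exists v => //; exists (mk_unit vI); split => // vbad.
  by apply: nbad; exists (mk_unit vI).
pose h := ext0 f; pose e v := eigenfun beta z v.
have h_eq v : good v -> h v = z * \sum_(k < nbranch beta) h ((v + k%:R) / beta).
  move=> gv; have [x [xv v1 nbx]] := gv; rewrite -xv in v1 *.
  have xT : \val x <> orbit beta 1.
    move=> xT; apply: nbx; suff -> : x = tau one by exact: bad_tau.
    by apply/val_inj; rewrite xT.
  have /eqP := fA x (fun Ax => nbx (bad_A x Ax)).
  rewrite -[X in X == 0]/(transfer beta f x - lam * f x) subr_eq0 => /eqP.
  rewrite transfer_ext0// -/h => E; rewrite {1}/h ext0_val//.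
  apply: (mulfI lam0); rewrite -E /z invfM fmorphV; field.
  by rewrite lam0 fmorph_eq0 gt_eqF.
have [S HS] := bv_bounded (elimT (bv_predP _) (bv_funP f)).
have hS v : good v -> modulus (h v) <= S.
  by move=> [x [<- x1 _]]; rewrite /h ext0_val// -lecR -normE.
have /choice[y yP] n : exists v, good v /\ 1 - n.+1%:R^-1 < v.
  have [|v gv vn] := good_near (1 - n.+1%:R^-1); last by exists v.
  by rewrite gtrBl invr_gt0 ltr0n.
have [c cP] := bolzano_weierstrass (fun n => hS _ (yP n).1).
pose g v := h v - c * e v.
have g_ge1 v : 1 <= v -> g v = 0.
  by move=> v1; rewrite /g /h /e ext0_ge1// eigenfun_ge1// mulr0 subrr.
have g_eq v : good v -> g v = z * (\sum_(k < nbranch beta) g ((v + k%:R) / beta)) +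
    - (c * beta_series beta z).
  move=> gv; rewrite /g h_eq// sumrB -mulr_sumr mulrBr [z * (c * _)]mulrCA.
  by rewrite eigenfun_transfer ?good_itv// -/(e v); ring.
have [M HM] := is_bounded_variation_modulus (elimT (bv_predP _) (bv_funP f)).
have g_bv (t : nat -> R) n : {homo t : i j / (i <= j)%N >-> i <= j} ->
    (forall i, good (t i)) -> \sum_(i < n) modulus (g (t i.+1) - g (t i)) <=
    M + modulus c * (2 / (1 - modulus z)).
  move=> tm /choice[t' t'P].
  have hE i : h (t i) = f (t' i).
    by have [<- t1 _] := t'P i; rewrite /h ext0_val//; have [->] := t'P i.
  apply: (@le_trans _ _ (\sum_(i < n) (modulus (f (t' i.+1) - f (t' i)) +
      modulus c * modulus (e (t i.+1) - e (t i))))).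
    apply: ler_sum => i _; rewrite -modulusM -[modulus (c * _)]modulusN.
    apply: le_trans (modulusD _ _); rewrite le_eqVlt; apply/orP; left; apply/eqP.
    by rewrite /g !hE; congr modulus; ring.
  rewrite big_split/= -mulr_sumr lerD//.
    by apply: HM => i j ij; have [-> _ _] := t'P i; have [-> _ _] := t'P j; exact: tm.
  by rewrite ler_wpM2l ?modulus_ge0// eigenfun_variation.
have g_near1 d a : 0 < d -> a < 1 -> exists2 v, good v & a < v /\ modulus (g v) < d.
  move=> d0 a1; have d2 : 0 < d / 2 by rewrite divr_gt0.
  have c0 : 0 < modulus c + 1 by rewrite ltr_wpDl ?modulus_ge0.
  have [r /= r0 Hr] := eigenfun_near1 beta z1 (divr_gt0 d2 c0).
  pose a' := Num.max a (1 - r).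
  have a'1 : 0 < 1 - a' by rewrite subr_gt0 gt_max a1 gtrBl.
  have [n nlarge hn] := cP _ d2 (Num.truncn (1 - a')^-1).
  have [gn yn] := yP n; have /andP[_ yn1] := good_itv _ gn.
  have : a' < y n.
    apply: le_lt_trans yn; rewrite lerBrDr -lerBrDl -[leRHS]invrK.
    rewrite lef_pV2 ?posrE ?ltr0n ?invr_gt0// ltW// (lt_le_trans (truncnS_gt _))//.
    by rewrite ler_nat ltnS.
  rewrite gt_max => /andP[ay ry]; exists (y n) => //; split => //.
  have en : modulus (e (y n) - 1) < d / 2 / (modulus c + 1).
    by apply: Hr => //; rewrite /ball_/= ger0_norm; lra.
  have -> : g (y n) = (h (y n) - c) + - (c * (e (y n) - 1)) by rewrite /g; ring.
  apply: (le_lt_trans (modulusD _ _)); rewrite modulusN modulusM [d]splitr ltr_leD//.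
  rewrite (le_trans (ler_wpM2l (modulus_ge0 c) (ltW en)))//.
  by rewrite mulrCA ger_pMr// ler_pdivrMr// mul1r lerDl.
have g0 v : good v -> g v = 0.
  exact: (contraction_eq0 b1 z1 good_itv good_preimage g_ge1 g_eq g_bv g_near1).
have [v gv _] := good_near 0 ltr01.
have := g_eq v gv; rewrite g0// big1 => [|k _]; last first.
  by case: (good_preimage v k gv) => [/g0|/g_ge1].
rewrite mulr0 add0r => /esym/eqP; rewrite oppr_eq0 mulf_eq0 => /orP[/eqP c0|/eqP //].
exfalso; move/negP: f_nonnull; apply; apply/asboolP; exists bad; split => // x nbx.
have x1 : \val x < 1.
  have /andP[_ x1] := unit_itvP x; rewrite lt_def x1 andbT eq_sym.
  by apply/eqP => xE; apply: nbx; suff -> : x = one by []; exact/val_inj.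
have : g (\val x) = 0 by apply: g0; exists x.
by rewrite /g c0 mul0r subr0 /h ext0_val.
Qed.

Lemma non_leading_has_zeros (b : betas R) :
  (exists lam, non_leading_eigenvalue b lam) <-> has_zeros (\val b) 2.
Proof.
have b1 := betas_gt1 b; have b0 : 0 < \val b := lt_trans ltr01 b1.
have B0 : (\val b)%:C != 0 :> R[i] by rewrite fmorph_eq0 gt_eqF.
have bi1 : modulus ((\val b)^-1)%:C < 1.
  by rewrite modulus_real gtr0_norm ?invr_gt0// invf_lt1.
split=> [[lam [[eig lamb] lam1]]|[zs [zs_inj zsP]]].
  move: lamb; rewrite normE ltcR => lamb.
  have lam0 : lam != 0 by rewrite -modulus_gt0 (lt_trans _ lamb)// invr_gt0.
  pose z := ((\val b)%:C * lam)^-1.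
  have zb : z != ((\val b)^-1)%:C.
    apply: contra lam1 => /eqP; rewrite /z fmorphV => /invr_inj.
    by rewrite -[RHS]mulr1 => /(mulfI B0) ->.
  exists (fun i => if i == 0 then ((\val b)^-1)%:C else z); split.
    move=> i j; have [->|i0] := eqVneq i 0; have [->|j0] := eqVneq j 0 => //.
    - by move=> E; rewrite E eqxx in zb.
    - by move=> E; rewrite E eqxx in zb.
    - by case: i j i0 j0 => -[|[|//]] ? [[|[|//]] ?]// _ _ _; exact/val_inj.
  move=> i; case: ifP => _; first by split => //; exact: beta_series_inv.
  split; last exact: eigenvalue_is_zero.
  rewrite /z modulusV modulusM modulus_real gtr0_norm// invf_lt1.
    by rewrite mulrC -ltr_pdivrMr// div1r.
  by rewrite mulr_gt0 ?modulus_gt0.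
have [i zi] : exists i, zs i != ((\val b)^-1)%:C.
  have [z0|z0] := eqVneq (zs 0) ((\val b)^-1)%:C; last by exists 0.
  by exists 1; apply/eqP; rewrite -z0 => /zs_inj.
have [zi1 fzi] := zsP i.
have zi0 : zs i != 0.
  apply/eqP => z0; move: fzi; rewrite z0 /beta_series.
  rewrite (power_series_recl (beta_coef_bounded b1 (lexx _))) ?modulus0 ?ltr01//.
  by rewrite mul0r addr0 => /eqP; rewrite oner_eq0.
exists ((\val b)%:C * zs i)^-1; split; first split.
- exact: zero_is_eigenvalue.
- rewrite normE ltcR modulusV modulusM modulus_real gtr0_norm// ltf_pV2 ?posrE//.
    by rewrite gtr_pMr.
  by rewrite mulr_gt0 ?modulus_gt0.
- apply: contra zi => /eqP E; apply/eqP; apply: (mulfI B0).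
  by rewrite fmorphV divff// -[LHS]invrK E invr1.
Qed.

End spectrum.

(** * Counting zeros *)

Lemma card_zerosE (R : realType) (b : R) N : 1 < b ->
  (`I_N #<= [set z : R[i] | `|z| < 1 /\ 1 - phi b (b%:C * z) = 0])%card <->
  has_zeros b N.
Proof.
move=> b1; split=> [/pcard_leP[f]|[zs [zs_inj zsP]]].
  exists (fun i : 'I_N => f i); split=> [i j fij|i].
    by apply/val_inj; apply: ('inj_f) fij; rewrite inE; exact: ltn_ord.
  have [zi fzi] := @funS _ _ _ _ f i (ltn_ord i).
  by rewrite -norm_lt1 -phi_beta_series.
pose f n := oapp zs 0 (insub n : option 'I_N).
have fE (i : 'I_N) : f i = zs i by rewrite /f valK.
have f_inj : {in `I_N &, injective f}.
  move=> i j; rewrite !inE => iN jN.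
  by rewrite (fE (Ordinal iN)) (fE (Ordinal jN)) => /zs_inj[].
have /card_eqPle[_ le] := inj_card_eq f_inj.
apply: (card_le_trans le); apply: subset_card_le => _ [i iN <-].
have [zi fzi] := zsP (Ordinal iN).
rewrite (fE (Ordinal iN)); have z1 : `|zs (Ordinal iN)| < 1 by rewrite norm_lt1.
by split => //; rewrite phi_beta_series.
Qed.

Unset Implicit Arguments.

Theorem theorem2p12 (R : realType) :
  (forall N : nat, (1 <= N)%N ->
     let U : set (betas R) :=
       [set b | (`I_N #<= [set z : R[i] | `|z| < 1 /\
                            1 - phi (\val b) ((\val b)%:C * z) = 0])%card] in
     open U /\ dense U) /\
  (let V : set (betas R) :=
     [set b | exists lam : R[i], non_leading_eigenvalue b lam] in
   open V /\ dense V).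
Proof.
have H N : open [set b : betas R | has_zeros (\val b) N] /\
    dense [set b : betas R | has_zeros (\val b) N].
  split; first exact: (open_betas (P := fun b => has_zeros b N) (@has_zeros_near R ^~ N)).
  exact: (dense_betas (P := fun b => has_zeros b N) (@has_zeros_dense R N)).
split=> [N _ U|V].
  suff -> : U = [set b | has_zeros (\val b) N] by exact: H.
  apply/seteqP; split=> b; first by move=> /(card_zerosE N (betas_gt1 b)).
  by move=> /(card_zerosE N (betas_gt1 b)).
suff -> : V = [set b | has_zeros (\val b) 2] by exact: H.
by apply/seteqP; split=> b /non_leading_has_zeros.
Qed.
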